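(* Let $q\in\mathbb C$ with $\operatorname{Re} q>0$ and let $r>0$ satisfy $r\operatorname{Re} q>r_0$. Then any function $G_r\in\mathcal J_r$ can be extended to a $k$-quasiconformal automorphism of $\mathbb C$ with $k=A(r\operatorname{Re} q)$.
   Context: $\mathbb D=\{z\in\mathbb C:|z|<1\}$. The function $A$ of a real variable is $$A(x)=\frac{6x(1+x)}{(1+x)^3-3(5x-1)},$$ and $r_0$ denotes the largest real root of the equation $A(x)=1$, namely $r_0=1+2\sqrt7\cos\left(\frac13\arctan\frac{3\sqrt{31}}{8}\right)\approx5.92434$. A homeomorphism $h:\mathbb C\to\mathbb C$ is called $k$-quasiconformal if $h$ has locally integrable partial derivatives on $\mathbb C$ (in the sense of distributions) which satisfy $|h_{\bar z}|\le k|h_z|$ almost everywhere. Fix $q\in\mathbb C$ with $\operatorname{Re} q>0$. Consider generators $f$ on $\mathbb D$ with $f(0)=0$ and $f'(0)=q$; these are exactly the functions $f(z)=zp(z)$ with $p:\mathbb D\to\mathbb C$ holomorphic, $\operatorname{Re} p(z)\ge0$ on $\mathbb D$ and $p(0)=q$. It is known that for every such $f$ and every $r>0$ there is a unique holomorphic map $G_r:\mathbb D\to\mathbb D$ satisfying $G_r(w)+rf(G_r(w))=w$ for all $w\in\mathbb D$; it is univalent with $G_r(0)=0$, is written $G_r=(\mathrm{Id}+rf)^{-1}$, and is called the nonlinear resolvent of $f$ with parameter $r$. For $r>0$, $\mathcal J_r$ denotes the set of all resolvents $G_r=(\mathrm{Id}+rf)^{-1}$ of all such $f$ (with the fixed $q$).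 *)

(* Defs.v *)
From HB Require Import structures.
From mathcomp Require Import all_boot all_order all_algebra.
From mathcomp Require Import all_classical all_reals all_analysis.
From mathcomp.real_closed Require Import complex.
From mathcomp Require Import ring lra.

Set Implicit Arguments.
Unset Strict Implicit.
Unset Printing Implicit Defensive.

Import Order.TTheory GRing.Theory Num.Theory.
Import numFieldNormedType.Exports.

Local Open Scope classical_set_scope.
Local Open Scope ring_scope.
Local Open Scope complex_scope.

(* The complex plane over [R].  The regular module [^o] is what gives [R[i]]
   its topology and its structure of normed space over the field [R[i]], so
   that [derivable f z 1] below is complex differentiability. *)
Notation Cplane R := ((R[i])^o).

Section Constants.
Variable R : realType.

Definition A (x : R) : R :=
  6 * x * (1 + x) / ((1 + x) ^+ 3 - 3 * (5 * x - 1)).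

Definition r0 : R :=
  1 + 2 * Num.sqrt 7 * cos (atan (3 * Num.sqrt 31 / 8) / 3).

Let s : R := Num.sqrt 7.
Let a : R := 3 * Num.sqrt 31 / 8.
Let c : R := cos (atan a / 3).

Let s_gt0 : 0 < s. Proof. by rewrite sqrtr_gt0. Qed.
Let s2 : s ^+ 2 = 7. Proof. by rewrite sqr_sqrtr. Qed.

Let cos3 : 4 * c ^+ 3 - 3 * c = 8 / (7 * s).
Proof.
have -> : 4 * c ^+ 3 - 3 * c = cos (atan a).
  rewrite [in RHS](_ : atan a = atan a / 3 + atan a / 3 + atan a / 3); last by field.
  rewrite !cosD sinD -/c.
  have := cos2Dsin2 (atan a / 3); rewrite -/c.
  move: (sin _) => d dc.
  have -> : c = c * (c ^+ 2 + d ^+ 2) by rewrite dc mulr1.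
  have d2 : d ^+ 2 = 1 - c ^+ 2 by rewrite -dc; ring.
  rewrite d2 (_ : c * (c ^+ 2 + (1 - c ^+ 2)) = c); last by ring.
  have -> : (c * c - d * d) * c - (d * c + c * d) * d
            = c ^+ 3 - 3 * c * d ^+ 2 by ring.
  by rewrite d2; ring.
have a2 : 1 + a ^+ 2 = (7 * s / 8) ^+ 2.
  by rewrite /a !exprMn sqr_sqrtr// s2; field.
rewrite cos_atan a2 sqrtr_sqr ger0_norm; last by have := s_gt0; lra.
by field; rewrite gt_eqF.
Qed.

Let c_gt0 : 0 < c.
Proof.
have := atan_gtNpi2 a; have := atan_ltpi2 a; have := pi_gt0 R => ? ? ?.
by apply: cos_gt0_pihalf; apply/andP; split; lra.
Qed.

Let t : R := 2 * s * c.

Let t_gt0 : 0 < t. Proof. by rewrite /t !mulr_gt0. Qed.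

Let t3 : t ^+ 3 - 21 * t = 16.
Proof.
rewrite /t.
have -> : (2 * s * c) ^+ 3 - 21 * (2 * s * c)
   = 14 * s * (4 * c ^+ 3 - 3 * c) + 8 * (s ^+ 2 - 7) * s * c ^+ 3 by ring.
by rewrite cos3 s2; field; rewrite gt_eqF.
Qed.

Let t2 : 21 < t ^+ 2.
Proof.
have : 0 < t * (t ^+ 2 - 21).
  have -> : t * (t ^+ 2 - 21) = t ^+ 3 - 21 * t by ring.
  by rewrite t3.
by rewrite pmulr_rgt0 // subr_gt0.
Qed.

Lemma r0_largest_root : A r0 = 1 /\ forall x : R, A x = 1 -> x <= r0.
Proof.
have r0E : r0 = 1 + t by [].
rewrite r0E; split.
  have den0 : 0 < 6 * (1 + t) * (1 + (1 + t)).
    by rewrite !mulr_gt0//; have := t_gt0; lra.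
  rewrite /A.
  have -> : (1 + (1 + t)) ^+ 3 - 3 * (5 * (1 + t) - 1)
     = 6 * (1 + t) * (1 + (1 + t)) + (t ^+ 3 - 21 * t - 16) by ring.
  by rewrite t3 subrr addr0 divff// gt_eqF.
move=> x; rewrite /A; set den := (X in _ / X) => Ax.
have den0 : den != 0.
  by apply/eqP => d0; move: Ax; rewrite d0 invr0 mulr0 => /esym/eqP; rewrite oner_eq0.
have {Ax} : 6 * x * (1 + x) = den.
  by rewrite -(divfK den0 (6 * x * (1 + x))) Ax mul1r.
rewrite /den => xE; rewrite leNgt; apply/negP => tx.
pose u := x - 1.
have u3 : u ^+ 3 - 21 * u = 16.
  have -> : u ^+ 3 - 21 * u
    = ((1 + x) ^+ 3 - 3 * (5 * x - 1)) - 6 * x * (1 + x) + 16.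
    by rewrite /u; ring.
  by rewrite xE; ring.
have tu : t < u by rewrite /u; lra.
have : (u - t) * (u ^+ 2 + u * t + (t ^+ 2 - 21)) = 0.
  by rewrite -[RHS](subrr 16) -{1}u3 -t3; ring.
apply/eqP; rewrite gt_eqF// mulr_gt0 ?subr_gt0//.
have u_gt0 : 0 < u := lt_trans t_gt0 tu.
have := exprn_gt0 2 u_gt0; have := mulr_gt0 u_gt0 t_gt0; have := t2.
by lra.
Qed.

End Constants.

Section Resolvents.
Variable R : realType.
Local Notation C := (Cplane R).

Definition holomorphic_on_disc (f : C -> C) : Prop :=
  forall z : C, `|z| < 1 -> derivable f z 1.

(* Generators on the unit disc with f(0) = 0 and f'(0) = q, in
   Berkson-Porta form.  Only the values on the disc are constrained. *)
Definition generator (q : C) (f : C -> C) : Prop :=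
  exists p : C -> C,
    [/\ holomorphic_on_disc p,
        forall z : C, `|z| < 1 -> 0 <= complex.Re (p z),
        p 0 = q &
        forall z : C, `|z| < 1 -> f z = z * p z].

Definition is_resolvent (r : R) (f G : C -> C) : Prop :=
  [/\ holomorphic_on_disc G,
      forall w : C, `|w| < 1 -> `|G w| < 1 &
      forall w : C, `|w| < 1 -> G w + r%:C * f (G w) = w].

Definition resolvents (q : C) (r : R) : set (C -> C) :=
  [set G | exists2 f, generator q f & is_resolvent r f G].

End Resolvents.

Section Quasiconformal.
Variable R : realType.
Local Notation C := (Cplane R).
Local Notation plane := (R * R)%type.

Definition lebesgue2 := (@lebesgue_measure R \x @lebesgue_measure R)%E.

Definition e1 : plane := (1, 0).
Definition e2 : plane := (0, 1).

(* [true] stands for d/dx and [false] for d/dy. *)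
Definition iterated_partial (phi : plane -> R) (ds : seq bool) : plane -> R :=
  foldr (fun b (g : plane -> R) p => 'D_(if b then e1 else e2) g p) phi ds.

Definition smooth (phi : plane -> R) : Prop :=
  forall ds, let g := iterated_partial phi ds in
    [/\ continuous g,
        forall p, derivable g p e1 &
        forall p, derivable g p e2].

Definition test_function (phi : plane -> R) : Prop :=
  smooth phi /\
  exists K : set plane, compact K /\ forall p, ~ K p -> phi p = 0.

Definition locally_integrable2 (g : plane -> R) : Prop :=
  measurable_fun setT g /\
  forall K : set plane, compact K -> lebesgue2.-integrable K (EFin \o g).

(* Below, [u] is a component of a homeomorphism, hence continuous, so both
   integrands are integrable and [Rintegral] takes no default value.  Real test
   functions suffice, complex ones following by linearity. *)
Definition weak_derivative (v : plane) (u g : plane -> R) : Prop :=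
  locally_integrable2 g /\
  forall phi, test_function phi ->
    \int[lebesgue2]_p (u p * 'D_v phi p) = - \int[lebesgue2]_p (g p * phi p).

Definition weak_derivativeC (v : plane) (F H : plane -> C) : Prop :=
  weak_derivative v (fun p => complex.Re (F p)) (fun p => complex.Re (H p)) /\
  weak_derivative v (fun p => complex.Im (F p)) (fun p => complex.Im (H p)).

Definition homeomorphism (h : C -> C) : Prop :=
  continuous h /\
  exists g : C -> C, [/\ continuous g, cancel h g & cancel g h].

Definition quasiconformal (k : R) (h : C -> C) : Prop :=
  homeomorphism h /\
  exists hx hy : plane -> C,
    let hz p := (hx p - (0 +i* 1) * hy p) / 2 in
    let hzbar p := (hx p + (0 +i* 1) * hy p) / 2 in
    [/\ weak_derivativeC e1 (fun p => h (p.1 +i* p.2)) hx,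
        weak_derivativeC e2 (fun p => h (p.1 +i* p.2)) hy &
        {ae lebesgue2, forall p, `|hzbar p| <= k%:C * `|hz p|}].

End Quasiconformal.

Arguments r0 R : clear implicits.

(* Main.v *)
Require Import Defs.
From mathcomp Require Import all_boot all_order all_algebra.
From mathcomp Require Import all_classical all_reals all_analysis.
From mathcomp Require Import measurable_realfun.
From mathcomp.real_closed Require Import complex.
From mathcomp Require Import ring lra.
Import Order.TTheory GRing.Theory Num.Theory.
Import numFieldNormedType.Exports.
Import Normc.
Set Implicit Arguments.
Unset Strict Implicit.
Unset Printing Implicit Defensive.
Local Open Scope classical_set_scope.
Local Open Scope ring_scope.
Local Open Scope complex_scope.

(* Put P = r p, so that G inverts z (1 + P z), and x = Re P(0) = r Re q.
   For F holomorphic on the disc with Re F >= 0, the mean over |w| = s of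
   F(w) (2 - s/w - w/s) has nonnegative real part and, by Goursat's theorem in
   logarithmic coordinates, equals 2 F(0) - s F'(0); hence |F'(0)| <= 2 Re F(0).
   Moebius invariance and integration along radii give the growth estimates of
   the Caratheodory class.  They force |G| <= 1/(x - 1), and then
   1/G' = 1 + (z P)'(G) lies in the disc of centre 1 + P(0) and radius
   A(x) |1 + P(0)|.  Inverting this disc, |G' - c| <= A(x) |c| for a constant c,
   so g = G - c z is A(x)|c|-Lipschitz and
   h(z) = c z + g(z) for |z| <= 1,  h(z) = c z + g(1/conj z) for |z| > 1
   is a Lipschitz perturbation of c z with h_z = c, |h_zbar| <= A(x)|c| outside
   the disc. *)

(** The weight 2 - s/w - w/s equals 2 - 2 cos t at w = s exp(it), which gives the sign of the mean.
    In logarithmic coordinates the circles about 0 become vertical segments of length 2 pi, so a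
    rectangle is the only contour, and the origin moves off to Re = - infinity: differentiability of
    F at 0 alone yields the limit of the means over small circles. The obstacle at the end is the
    unit circle, since G is known only in the open disc and h is glued along its boundary. Comparing
    G' with one constant c settles every point at once. The disc is convex, so g is Lipschitz and
    extends to the circle; reflection keeps the Lipschitz constant; a Lipschitz function has its
    pointwise partial derivatives as weak ones as soon as they exist off a null set, here the
    circle; and A(x) |c| < |c| makes h bi-Lipschitz and onto. The condition x > r_0 enters as A(x) <
    1, and through x > 28/5 in the estimate that produces the radius A(x) |1 + P(0)|. *)

(** * Lebesgue measure on the plane *)

Section Plane.
Variable R : realType.
Local Notation plane := (R * R)%type.
Local Notation mu2 := (@lebesgue2 R).

(** Measurability refers to the product sigma-algebra, so an open set is written as a countable
    union of open squares with rational centres and half-sides 1/(n+1). *)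
Lemma open_measurable2 (O : set plane) : open O -> measurable O.
Proof.
move=> oO.
pose B (i : rat * rat * nat) : set plane :=
  `](ratr i.1.1 - i.2.+1%:R^-1 : R), (ratr i.1.1 + i.2.+1%:R^-1)[ `*`
  `](ratr i.1.2 - i.2.+1%:R^-1 : R), (ratr i.1.2 + i.2.+1%:R^-1)[.
have mB i : measurable (B i) by apply: measurableX; apply: measurable_itv.
rewrite (_ : O = \bigcup_i (if `[< B i `<=` O >] then B i else set0)).
  apply: countable_bigcupT_measurable; first exact: countableP.
  by move=> i; case: ifP => _ //; exact: measurable0.
apply/seteqP; split=> [[x y] Oxy|p [i _]]; last first.
  by case: ifPn => // /asboolP iO /iO.
have /nbhs_ballP[e /= e0 eO] : nbhs (x, y) O by apply: open_nbhs_nbhs; split.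
(* The factor 2: the rational centre is within d of the point in each coordinate, and the square
   extends d further. *)
have [n ne] : exists n, 2 * n.+1%:R^-1 < e :> R.
  have [n _ /(_ n (leqnn n)) nE] :=
    near_infty_natSinv_lt (PosNum (divr_gt0 e0 (ltr0n R 2))).
  exists n; have : n.+1%:R^-1 < e / 2 by exact: nE.
  by move: (n.+1%:R^-1 : R) => d; lra.
have d0 : 0 < n.+1%:R^-1 :> R by rewrite invr_gt0.
move: ne d0; set d := n.+1%:R^-1 => ne d0.
have rd z : exists a : rat, `|z - ratr a| < d.
  have [|a] := @rat_in_itvoo R (z - d) (z + d); first by lra.
  rewrite in_itv/= => /andP[? ?]; exists a.
  by rewrite ltr_norml; apply/andP; split; lra.
have [a ad] := rd x; have [b bd] := rd y.
exists (a, b, n) => //.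
have -> : `[< B (a, b, n) `<=` O >].
  apply/asboolP => -[s t] [/=]; rewrite !in_itv/= -/d => /andP[? ?] /andP[? ?].
  apply: eO; split => /=; rewrite /ball/= /ball_/= ltr_norml; apply/andP;
  move: ad bd; rewrite !ltr_norml => /andP[? ?] /andP[? ?]; split; lra.
move: ad bd; rewrite !ltr_norml => /andP[? ?] /andP[? ?].
by split => /=; rewrite in_itv/= -/d; apply/andP; split; lra.
Qed.

Lemma continuous_measurable_fun2 (g : plane -> R) :
  continuous g -> measurable_fun setT g.
Proof.
move=> /continuousP cg; apply: (measurability _ (RGenOInfty.measurableE R)).
move=> _ [_ [a ->] <-]; rewrite setTI; apply: open_measurable2.
exact/cg/interval_open.
Qed.

Definition shift1 (a : R) : measurableTypeR R -> measurableTypeR R := fun x => x + a.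

Lemma measurable_shift (a : R) : measurable_fun setT (shift1 a).
Proof. by apply: measurable_funD => //; exact: measurable_cst. Qed.

(** Uniqueness of Lebesgue measure: the pushforward under the translation gives half-open intervals
    their length. *)
Lemma lebesgue_measure_shift (a : R) (X : set R) : measurable X ->
  lebesgue_measure ((fun x : R => x + a) @^-1` X) = lebesgue_measure X.
Proof.
move=> mX.
suff : pushforward lebesgue_measure (shift1 a) X = lebesgue_measure X by [].
apply/esym/lebesgue_measure_unique => //=; first exact: measurable_shift.

move=> _ _ [[b c]] _ <-.
rewrite /pushforward/=.
have -> : shift1 a @^-1` `]b, c] = `]b - a, c - a]%classic.
  by apply/seteqP; split=> x /=; rewrite /shift1 !in_itv/= => /andP[? ?]; apply/andP; split; lra.
rewrite !lebesgue_measure_itv/= !lte_fin ltrD2r; case: ifP => // _.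
by rewrite -!EFinB; congr EFin; ring.
Qed.

Definition shift2 (v : plane) (p : measurableTypeR R * measurableTypeR R) :
  measurableTypeR R * measurableTypeR R := (p.1 + v.1, p.2 + v.2).

Lemma measurable_shift2 (v : plane) : measurable_fun setT (shift2 v).
Proof.
by apply: measurable_fun_pair; apply: (measurableT_comp (measurable_shift _)).
Qed.

(** Uniqueness of the product measure reduces the claim to rectangles, where the translation acts on
    each factor. *)
Lemma lebesgue2_shift (v : plane) (X : set plane) : measurable X ->
  mu2 (shift2 v @^-1` X) = mu2 X.
Proof.
move=> mX.
suff : pushforward mu2 (shift2 v) X = mu2 X by [].
apply/esym/product_measure_unique => //; first exact: measurable_shift2.
move=> E A B mA mB; rewrite /pushforward.
transitivity (mu2 (((fun x : R => x + v.1) @^-1` A) `*` ((fun x : R => x + v.2) @^-1` B))).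
  by [].
rewrite /lebesgue2 product_measure1E.
- by congr (_ * _)%E; exact: lebesgue_measure_shift.
- by rewrite -[X in measurable X]setTI; exact: measurable_shift.
- by rewrite -[X in measurable X]setTI; exact: measurable_shift.
Qed.

Lemma Rintegral_shift2 (v : plane) (f : plane -> R) :
  measurable_fun setT f ->
  mu2.-integrable setT (fun p => (f (p + v))%:E) ->
  \int[mu2]_p f (p + v) = \int[mu2]_p f p.
Proof.
move=> mf intf; rewrite /Rintegral; congr fine.
transitivity (\int[pushforward mu2 (shift2 v)]_p (f p)%:E)%E.
  rewrite (integral_pushforward (measurable_shift2 v)) //.
  exact/measurable_EFinP.
apply: eq_measure_integral => [|mf' A mA _]; first exact: measurable_shift2.
exact: lebesgue2_shift.
Qed.

End Plane.

(** * Integrals of bounded functions supported in a box *)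

Section Weak.
Variable R : realType.
Local Notation plane := (R * R)%type.
Local Notation mu2 := (@lebesgue2 R).

Definition box (N : R) : set plane := `[- N, N] `*` `[- N, N].

Lemma measurable_box N : measurable (box N).
Proof. by apply: measurableX; apply: measurable_itv. Qed.

Lemma boxP N (p : plane) : box N p <-> `|p| <= N.
Proof.
rewrite /box/= !in_itv/= -!ler_norml prod_normE/= ge_max.
by split=> [[-> ->]|/andP].
Qed.

Lemma lebesgue2_box N : (mu2 (box N) < +oo)%E.
Proof.
have -> : mu2 (box N) = (lebesgue_measure (`[(- N)%R, N] : set R) *
    lebesgue_measure (`[(- N)%R, N] : set R))%E.
  by apply: product_measure1E; exact: measurable_itv.
rewrite lebesgue_measure_itv/=; case: ifP => _; last by rewrite mul0e.
by rewrite -EFinD -EFinM ltry.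
Qed.

Lemma compact_box (K : set plane) : compact K -> exists N, K `<=` box N.
Proof.
move=> /compact_bounded [M [_ KM]]; exists (M + 1) => p Kp.
by apply/boxP/(KM (M + 1)) => //; lra.
Qed.

Lemma compact_measurable2 (K : set plane) : compact K -> measurable K.
Proof.
move=> /compact_closed cK; rewrite -[K]setCK; apply: measurableC.
apply: open_measurable2; apply: closed_openC; apply: cK.
exact: norm_hausdorff.
Qed.

Lemma bounded_integrable2 (K : set plane) (f : plane -> R) (N C : R) :
  measurable K -> K `<=` box N ->
  measurable_fun setT f -> (forall p, `|f p| <= C) ->
  mu2.-integrable K (EFin \o f).
Proof.
move=> mK KN mf fC; apply: (@integrableS _ _ _ mu2 (box N)) => //; first exact: measurable_box.
apply: measurable_bounded_integrable; first exact: measurable_box.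
- exact: lebesgue2_box.
- exact: measurable_funS mf.
- exists C; split; first exact: num_real.
  by move=> x Cx p _ /=; rewrite (le_trans (fC _))// ltW.
Qed.

Lemma boxed_integrable (f : plane -> R) (N C : R) :
  measurable_fun setT f -> (forall p, `|f p| <= C) ->
  (forall p, ~ box N p -> f p = 0) -> mu2.-integrable setT (EFin \o f).
Proof.
move=> mf fC f0.
have -> : EFin \o f = (EFin \o f) \_ (box N).
  apply/funext => p; rewrite patchE; case: ifPn => // /negP pN /=.
  by rewrite f0// => /mem_set.
have := @integrable_mkcond _ _ _ mu2 (box N) (EFin \o f) (measurable_box N).
case=> + _; apply.
apply: (@bounded_integrable2 (box N) f N C) => //; exact: measurable_box.
Qed.

(** Dominated convergence with majorant C times the indicator of the box. The null set Z leaves room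
    for the unit circle, where the derivative of the extension may fail to exist. *)
Lemma boxed_Rintegral_cvg (f_ : (plane -> R)^nat) (f : plane -> R) (Z : set plane) (N C : R) :
  (forall n, measurable_fun setT (f_ n)) -> measurable_fun setT f ->
  (forall n p, `|f_ n p| <= C) -> (forall n p, ~ box N p -> f_ n p = 0) ->
  mu2 Z = 0%E -> measurable Z ->
  (forall p, ~ Z p -> f_ n p @[n --> \oo] --> f p) ->
  \int[mu2]_p f_ n p @[n --> \oo] --> \int[mu2]_p f p.
Proof.
move=> mf_ mf fC f0 Z0 mZ f_f.
have C0 : 0 <= C by apply: le_trans (fC 0%N 0).
pose g (p : plane) := C * \1_(box N) p.
have mg : measurable_fun setT g.
  by apply: measurable_funM => //; apply: measurable_indic; exact: measurable_box.
have ig : mu2.-integrable setT (EFin \o g).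
  apply: (@boxed_integrable _ N C) => // p.
  - by rewrite /g indicE; case: (_ \in _); rewrite ?mulr1 ?mulr0 ?normr0 ?ger0_norm.
  - by move=> pN; rewrite /g indicE memNset ?mulr0.
have fg n p : `|f_ n p| <= g p.
  rewrite /g indicE; case: (boolP (_ \in _)) => [_|/negP pN]; first by rewrite mulr1.
  by rewrite f0 ?normr0 ?mulr0// => ?; apply: pN; apply: mem_set.
have mE (h : plane -> R) : measurable_fun setT h -> measurable_fun setT (EFin \o h).
  by move=> mh; exact/measurable_EFinP.
have [iF _ cF] : [/\ mu2.-integrable setT (EFin \o f),
    [sequence (\int[mu2]_x `|(EFin \o f_ n) x - (EFin \o f) x|)%E]_n @ \oo --> 0%E
  & [sequence (\int[mu2]_x (EFin \o f_ n) x)%E]_n @ \oo --> (\int[mu2]_x (EFin \o f) x)%E].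
  apply: (@dominated_convergence _ _ _ mu2 setT _ (fun n => EFin \o f_ n)
    (EFin \o f) (EFin \o g)) => //.
  - by move=> n; exact: mE.
  - exact: mE.
  - exists Z; split => // p /= H; apply: contrapT => nZ; apply: H => _.
    by apply: cvg_EFin; [exact: nearW | exact: f_f].
  - by apply: aeW => p n _; rewrite lee_fin.
rewrite /Rintegral; apply: fine_cvg; rewrite fineK//.
exact: integrable_fin_num.
Qed.
End Weak.

(** * Weak derivatives of Lipschitz functions *)

Section Weak.
Variable R : realType.
Local Notation plane := (R * R)%type.
Local Notation mu2 := (@lebesgue2 R).

(** Dominated convergence is about sequences, so the difference quotients are taken along a null
    sequence of steps. *)
Lemma derive_seq (V : normedModType R) (f : V -> R) (p v : V) (d : R) (h : R^nat) :
  is_derive p v f d -> (forall n, h n != 0) -> h @ \oo --> (0 : R) ->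
  (h n)^-1 * (f (p + h n *: v) - f p) @[n --> \oo] --> d.
Proof.
move=> [fd <-] h0 hc.
have hd : h @ \oo --> (0 : R)^'.
  move=> A [e /= e0 eA]; have /cvgrPdist_lt/(_ e e0) := hc.
  by apply: filterS => n /eA; apply.
have := cvg_comp _ _ hd fd.
rewrite /= /derive => H; apply: cvg_trans H; apply: near_eq_cvg.
by apply: nearW => n /=; rewrite [p + _]addrC.
Qed.

Lemma derive_line (f : plane -> R) (p v : plane) (s : R) : derivable f (p + s *: v) v ->
  is_derive s 1 (fun s => f (p + s *: v)) ('D_v f (p + s *: v)).
Proof.
move=> fd.
have E : (fun h : R => h^-1 *: (((fun s => f (p + s *: v)) \o shift s) (h *: 1) - f (p + s *: v)))
     = (fun h : R => h^-1 *: ((f \o shift (p + s *: v)) (h *: v) - f (p + s *: v))).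
  apply/funext => h /=; congr (_ *: (f _ - _)).
  by rewrite scalerDl /GRing.scale/= mulr1 addrCA.
by split; rewrite /derivable /derive E.
Qed.

(** The mean value theorem on a segment; it bounds the difference quotients of a test function
    uniformly in the step. *)
Lemma derive_line_lipschitz (f : plane -> R) (v : plane) C p (t : R) : 0 <= t ->
  (forall p, derivable f p v) -> (forall p, `|'D_v f p| <= C) ->
  `|f (p + t *: v) - f p| <= C * t.
Proof.
move=> t0 fd fC.
have fl s := derive_line (fd (p + s *: v)).
have [|c _] := @MVT_segment _ _ _ 0 t t0 (fun s _ => fl s).
  apply: continuous_subspaceT => s; apply: differentiable_continuous.
  by apply/derivable1_diffP; have [] := fl s.
by rewrite subr0 scale0r addr0 => ->; rewrite normrM (ger0_norm t0) ler_wpM2r.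
Qed.

Lemma test_function_bounds (phi : plane -> R) (v : plane) :
  test_function phi -> v = @e1 R \/ v = @e2 R ->
  [/\ continuous phi, (forall p, derivable phi p v), continuous ('D_v phi) &
   exists N C, (forall p, ~ box N p -> phi p = 0) /\
      (forall p, `|phi p| <= C /\ `|'D_v phi p| <= C)].
Proof.
move=> [smphi [K [cK K0]]] ve.
have [cphi d1 d2] := smphi [::].
have dv p : derivable phi p v by case: ve => ->; [exact: d1|exact: d2].
have cDv : continuous ('D_v phi).
  have [c1 _ _] := smphi [:: true]; have [c2 _ _] := smphi [:: false].
  by case: ve => ->; [exact: c1|exact: c2].
split => //.
have [N KN] := compact_box cK.
(* The complement of the compact K is open, so phi vanishes near p and not only at p. *)
have DK0 p : ~ K p -> 'D_v phi p = 0.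
  move=> nKp; rewrite -(derive_cst (0:R) p v); apply: near_eq_derive.
  have oK : open (~` K).
    by apply: closed_openC; apply: compact_closed => //; exact: norm_hausdorff.
  have : nbhs p (~` K) by apply: open_nbhs_nbhs.
  by apply: filterS => q /K0.
have bnd (f : plane -> R) : continuous f -> (forall p, ~ K p -> f p = 0) ->
    exists C, forall p, `|f p| <= C.
  move=> cf f0.
  have /compact_bounded[M [_ HM]] : compact (f @` K).
    by apply: continuous_compact => //; exact: continuous_subspaceT.
  exists (Num.max 0 (M + 1)) => p; have [Kp|nKp] := pselect (K p).
    by rewrite le_max; apply/orP; right; apply: (HM (M + 1)); [rewrite ltrDl|exists p].
  by rewrite f0// normr0 le_max lexx.
have [C1 HC1] := bnd _ cphi K0; have [C2 HC2] := bnd _ cDv DK0.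
exists N, (Num.max C1 C2); split=> [p pN|p]; first by apply: K0 => /KN.
by rewrite !le_max HC1 HC2 orbT.
Qed.

(* Translation invariance gives the integration by parts for difference
   quotients, and dominated convergence passes to the limit. *)
Lemma lipschitz_weak_derivative (v : plane) (u g : plane -> R) (L : R) (Z : set plane) :
  v = @e1 R \/ v = @e2 R ->
  (forall p p', `|u p - u p'| <= L * `|p - p'|) ->
  measurable Z -> mu2 Z = 0%E -> (forall p, Z p -> g p = 0) ->
  (forall p, ~ Z p -> is_derive p v u (g p)) ->
  weak_derivative v u g.
Proof.
move=> ve uL mZ Z0 gZ gD.
have v1 : `|v| = 1.
  by case: ve => ->; rewrite prod_normE/= normr0 normr1; [apply/max_idPl|apply/max_idPr].
have cu : continuous u.
  move=> p; apply/cvgrPdist_le => e e0; near=> q; rewrite (le_trans (uL _ _))//.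
  have L1 : L <= `|L| + 1 by have := ler_norm L; lra.
  apply: (@le_trans _ _ ((`|L| + 1) * `|p - q|)); first exact: ler_wpM2r.
  have L0 : 0 < `|L| + 1 by have := normr_ge0 L; lra.
  rewrite -ler_pdivlMl//; near: q; have /cvgrPdist_le := @cvg_id _ (nbhs p).
  by apply; rewrite mulr_gt0// invr_gt0.
pose h (n : nat) : R := n.+1%:R^-1.
have hgt0 n : 0 < h n by rewrite invr_gt0.
have hle1 n : h n <= 1 by rewrite invf_le1// ler1n.
have hne0 n : h n != 0 by rewrite gt_eqF.
have hc : h @ \oo --> (0:R) by exact: cvg_harmonic.
have hV n : `|(h n)^-1| = (h n)^-1 by rewrite ger0_norm// invr_ge0 ltW.
pose U n (p : plane) := (h n)^-1 * (u (p + h n *: v) - u p).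
have UL n p : `|U n p| <= L.
  rewrite /U normrM hV ler_pdivrMl// mulrC (le_trans (uL _ _))//.
  by rewrite addrC addKr normrZ v1 mulr1 ger0_norm// ltW.
have L0 : 0 <= L by apply: le_trans (UL 0%N 0).
have csh (f : plane -> R) (w : plane) : continuous f -> continuous (fun p : plane => f (p + w)).
  move=> cf p; have cw : (fun q : plane => q + w) @ p --> p + w.
    by apply: cvgD; [exact: cvg_id|exact: cvg_cst].
  exact: (cvg_comp _ _ cw (cf _)).
have cU n : continuous (U n).
  by move=> p; apply: cvgM; [exact: cvg_cst|apply: cvgB; [exact: (csh _ _ cu)|exact: cu]].
have Ug p : ~ Z p -> U n p @[n --> \oo] --> g p.
  by move=> nZ; exact: (derive_seq (gD _ nZ)).
(* As g vanishes on Z, it is the limit at every point of the measurable functions obtained by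
   cutting U n off to the complement of Z. *)
have mg : measurable_fun setT g.
  apply: (@measurable_fun_cvg _ _ _ _ (fun n p => \1_(~` Z) p * U n p)) => [n|p _].
    apply: measurable_funM; last exact: continuous_measurable_fun2.
    by apply: measurable_indic; exact: measurableC.
  have [Zp|nZp] := pselect (Z p).
    rewrite gZ// [X in X @ _ --> _](_ : _ = fun=> 0); first exact: cvg_cst.
    by apply/funext => n; rewrite indicE memNset ?mul0r// => /(_ Zp).
  rewrite [X in X @ _ --> _](_ : _ = U ^~ p); first exact: Ug.
  by apply/funext => n; rewrite indicE mem_set ?mul1r.
have gL p : `|g p| <= L.
  have [Zp|nZp] := pselect (Z p); first by rewrite gZ// normr0.
  have H : `|U n p| @[n --> \oo] --> `|g p| by exact: (cvg_norm (Ug p nZp)).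
  apply: (@ler_cvg_to _ \oo _ R (fun n => `|U n p|) (fun=> L) _ _ H (cvg_cst L)).
  by apply: nearW => n; exact: UL.
split.
  split=> // K cK; have [N KN] := compact_box cK.
  apply: (@bounded_integrable2 _ K g N L) => //; exact: compact_measurable2.
move=> phi tphi.
have [cphi dphi cDphi [N [C [phi0 phiC]]]] := test_function_bounds tphi ve.
(* The quotient of phi has step - h n: moving the translation from u to phi reverses its direction,
   and this is the minus sign of integration by parts. *)
pose P n (p : plane) := (- h n)^-1 * (phi (p + (- h n) *: v) - phi p).
have cP n : continuous (P n).
  by move=> p; apply: cvgM; [exact: cvg_cst|apply: cvgB; [exact: (csh _ _ cphi)|exact: cphi]].
have PC n p : `|P n p| <= C.
  rewrite /P normrM invrN normrN hV ler_pdivrMl// mulrC distrC.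
  have := @derive_line_lipschitz phi v C (p - h n *: v) (h n) (ltW (hgt0 n)) dphi.
  by rewrite subrK scaleNr; apply => q; have [] := phiC q.
(* All steps are at most 1, so enlarging the box by 1 contains the supports of all P n. *)
have outbox (p : plane) (t : R) : `|t| <= 1 -> ~ box (N + 1) p -> ~ box N (p + t *: v).
  move=> t1 + /boxP b; apply; apply/boxP.
  rewrite -[p](addrK (t *: v)) (le_trans (ler_normB _ _))// lerD//.
  by rewrite normrZ v1 mulr1.
have boxS p : ~ box (N + 1) p -> ~ box N p.
  by move=> + /boxP b; apply; apply/boxP; lra.
have P0 n p : ~ box (N + 1) p -> P n p = 0.
  move=> pN; rewrite /P !phi0 ?subr0 ?mulr0//; first exact: boxS.
  by apply: outbox => //; rewrite normrN ger0_norm// ltW.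
have PD p : P n p @[n --> \oo] --> 'D_v phi p.
  apply: (@derive_seq _ _ _ _ _ (fun n => - h n)).
  - exact/derivableP.
  - by move=> n; rewrite oppr_eq0.
  - by rewrite -oppr0; exact: cvgN.
have mc (f : plane -> R) : continuous f -> measurable_fun setT f.
  exact: continuous_measurable_fun2.
have [M uM] : exists M, forall p, box (N + 1) p -> `|u p| <= M.
  exists (`|u 0| + L * (N + 1)) => p /boxP pN.
  rewrite -[u p](subrK (u 0)) addrC (le_trans (ler_normD _ _))// lerD2l.
  by rewrite (le_trans (uL _ _))// subr0 ler_wpM2l.
have parts n : \int[mu2]_p (U n p * phi p) = - \int[mu2]_p (u p * P n p).
  have iU (w : plane) (f : plane -> R) K : `|w| <= 1 -> continuous f ->
      (forall p, `|f p| <= K) -> (forall p, ~ box N p -> f p = 0) ->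
      mu2.-integrable setT (fun p => (u (p + w) * f p)%:E).
    move=> w1 cf fK f0.
    apply: (@boxed_integrable _ _ N (`|M| * K)).
    - by apply: measurable_funM; apply: mc => //; exact: csh.
    - move=> p; have [pN|pN] := pselect (box N p); last first.
        by rewrite f0// mulr0 normr0 mulr_ge0//; apply: le_trans (fK 0).
      rewrite normrM ler_pM// (le_trans (uM _ _)) ?ler_norm//.
      apply/boxP; rewrite (le_trans (ler_normD _ _))// lerD//; exact/boxP.
    - by move=> p pN; rewrite f0// mulr0.
  have hv1 : `|h n *: v| <= 1 by rewrite normrZ v1 mulr1 ger0_norm// ltW.
  have phC p : `|phi p| <= C by have [] := phiC p.
  have C0 : 0 <= C by apply: le_trans (phC 0).
  have i1 := iU (h n *: v) phi C hv1 cphi phC phi0.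
  have i0 := iU 0 phi C _ cphi phC phi0.
  have {i0} i0 : mu2.-integrable setT (fun p => (u p * phi p)%:E).
    have := i0; rewrite normr0 ler01 => /(_ isT).
    by under eq_fun do rewrite addr0.
  have i2 : mu2.-integrable setT (fun p => (u p * phi (p - h n *: v))%:E).
    apply: (@boxed_integrable _ _ (N + 1) (`|M| * C)).
    - by apply: measurable_funM; apply: mc => //; exact: csh.
    - move=> p; have [pN|pN] := pselect (box (N + 1) p); last first.
        rewrite phi0 ?mulr0 ?normr0 ?mulr_ge0//.
        by rewrite -scaleNr; apply: outbox => //; rewrite normrN ger0_norm// ltW.
      by rewrite normrM ler_pM// (le_trans (uM _ pN)) ?ler_norm.
    - move=> p pN; rewrite phi0 ?mulr0// -scaleNr; apply: outbox => //.
      by rewrite normrN ger0_norm// ltW.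
  have shift : \int[mu2]_p (u (p + h n *: v) * phi p) = \int[mu2]_p (u p * phi (p - h n *: v)).
    rewrite -(@Rintegral_shift2 _ (h n *: v) (fun p => u p * phi (p - h n *: v))).
    - by apply: eq_Rintegral => p _; rewrite addrK.
    - by apply: measurable_funM; apply: mc => //; exact: csh.
    - by under eq_fun do rewrite addrK.
  have iB (a b : plane -> R) : mu2.-integrable setT (fun p => (a p)%:E) ->
      mu2.-integrable setT (fun p => (b p)%:E) ->
      mu2.-integrable setT (fun p => (a p - b p)%:E).
    by move=> ia ib; exact: (integrableB _ ia ib).
  have -> : \int[mu2]_p (U n p * phi p) =
      (h n)^-1 * (\int[mu2]_p (u (p + h n *: v) * phi p) - \int[mu2]_p (u p * phi p)).
    rewrite -RintegralB// -RintegralZl//; last exact: iB.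
    by apply: eq_Rintegral => p _; rewrite /U; ring.
  have -> : \int[mu2]_p (u p * P n p) =
      - (h n)^-1 * (\int[mu2]_p (u p * phi (p - h n *: v)) - \int[mu2]_p (u p * phi p)).
    rewrite -RintegralB// -RintegralZl//; last exact: iB.
    by apply: eq_Rintegral => p _; rewrite /P scaleNr invrN; ring.
  by rewrite shift; ring.
have lim1 : \int[mu2]_p (U n p * phi p) @[n --> \oo] --> \int[mu2]_p (g p * phi p).
  apply: (@boxed_Rintegral_cvg _ _ _ Z N (L * C)) => //.
  - by move=> n; apply: measurable_funM; apply: mc.
  - by apply: measurable_funM => //; apply: mc.
  - by move=> n p; rewrite normrM ler_pM//; have [] := phiC p.
  - by move=> n p pN; rewrite phi0// mulr0.
  - by move=> p nZ; apply: cvgM; [exact: Ug|exact: cvg_cst].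
have lim2 : \int[mu2]_p (u p * P n p) @[n --> \oo] --> \int[mu2]_p (u p * 'D_v phi p).
  apply: (@boxed_Rintegral_cvg _ _ _ set0 (N + 1) (`|M| * C)) => //.
  - by move=> n; apply: measurable_funM; apply: mc.
  - by apply: measurable_funM; apply: mc.
  - move=> n p; have [pN|pN] := pselect (box (N + 1) p).
      by rewrite normrM ler_pM// (le_trans (uM _ pN)) ?ler_norm.
    rewrite P0// mulr0 normr0 mulr_ge0//.
    by have [H _] := phiC 0; apply: le_trans H.
  - by move=> n p pN; rewrite P0// mulr0.
  - by move=> p _; apply: cvgM; [exact: cvg_cst|exact: PD].
apply: oppr_inj; rewrite opprK.
have lim3 : \int[mu2]_p (U n p * phi p) @[n --> \oo] --> - \int[mu2]_p (u p * 'D_v phi p).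
  rewrite (_ : (fun n => _) = fun n => - \int[mu2]_p (u p * P n p)).
    by apply: cvgN.
  exact/funext.
exact: (cvg_unique (@Rhausdorff R) lim3 lim1).
Unshelve. all: by end_near.
Qed.
End Weak.

(** * The unit circle is a null set *)

Section Circle.
Variable R : realType.
Local Notation plane := (R * R)%type.
Local Notation mu2 := (@lebesgue2 R).

Definition circle : set plane := [set p | p.1 ^+ 2 + p.2 ^+ 2 = 1].

Lemma measurable_circle : measurable circle.
Proof.
have mf : measurable_fun setT (fun p : plane => p.1 ^+ 2 + p.2 ^+ 2).
  by apply: measurable_funD; apply: measurable_funX.
rewrite (_ : circle = setT `&` (fun p : plane => p.1 ^+ 2 + p.2 ^+ 2) @^-1` [set 1]).
  exact: mf.
by rewrite setTI.
Qed.

(** Every vertical section lies in a set of at most two points, so the iterated integral that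
    defines the product measure vanishes. *)
Lemma lebesgue2_circle : mu2 circle = 0%E.
Proof.
rewrite /lebesgue2 /product_measure1.
rewrite (@eq_integral _ _ _ _ _ (cst 0%E)) ?integral0// => x _ /=.
(* For |x| > 1 the square root has the default value 0, and the section is empty. *)
pose s := Num.sqrt (1 - x ^+ 2).
apply: (@subset_measure0 _ _ _ (@lebesgue_measure R) _ ([set s] `|` [set - s])).
- exact: measurable_xsection measurable_circle.
- by apply: measurableU.
- move=> y; rewrite /xsection/= inE /circle/= => h.
  have /eqP : y ^+ 2 = s ^+ 2 by rewrite sqr_sqrtr -?h; [lra|rewrite addrAC subrr add0r sqr_ge0].
  by rewrite eqf_sqr => /orP[]/eqP; [left|right].
- by apply: countable_lebesgue_measure0; apply: finite_set_countable; exact: finite_set2.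
Qed.
End Circle.

(** * Complex differentiability *)

Section ComplexCalculus.
Variable R : realType.
Local Notation C := R[i].
Local Notation Re := complex.Re.
Local Notation Im := complex.Im.

Lemma norm_normc (z : C) : `|z| = (normc z)%:C. Proof. by []. Qed.

Lemma normc_ge0 (z : C) : 0 <= normc z.
Proof. by case: z => a b; exact: sqrtr_ge0. Qed.

Lemma normc_sqr (z : C) : normc z ^+ 2 = Re z ^+ 2 + Im z ^+ 2.
Proof. by case: z => a b /=; rewrite sqr_sqrtr// addr_ge0// sqr_ge0. Qed.

Lemma normc_eq0 (z : C) : (normc z == 0) = (z == 0).
Proof. by apply/eqP/eqP => [/eq0_normc//|->]; rewrite normc0. Qed.

Lemma normc_gt0 (z : C) : (0 < normc z) = (z != 0).
Proof. by rewrite lt_def normc_eq0 normc_ge0 andbT. Qed.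

Lemma normc_Re (z : C) : `|Re z| <= normc z.
Proof.
rewrite -(@ler_pXn2r _ 2) ?nnegrE ?normc_ge0// normc_sqr real_normK ?num_real//.
by rewrite lerDl sqr_ge0.
Qed.

Lemma normc_Im (z : C) : `|Im z| <= normc z.
Proof.
rewrite -(@ler_pXn2r _ 2) ?nnegrE ?normc_ge0// normc_sqr real_normK ?num_real//.
by rewrite lerDr sqr_ge0.
Qed.

Lemma normc_real (x : R) : normc x%:C = `|x|.
Proof. by rewrite /= expr0n addr0 sqrtr_sqr. Qed.

Lemma normc_ReIm (z : C) : normc z <= `|Re z| + `|Im z|.
Proof.
rewrite -(@ler_pXn2r _ 2) ?nnegrE ?normc_ge0 ?addr_ge0// normc_sqr sqrrD.
rewrite !real_normK ?num_real// addrAC lerDl.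
by rewrite mulrn_wge0// mulr_ge0.
Qed.

Lemma normc_conj (z : C) : normc (conjc z) = normc z.
Proof. by case: z => a b; rewrite /= sqrrN. Qed.

Lemma normcB (x y : C) : normc (x - y) = normc (y - x).
Proof. by rewrite -normcN opprB. Qed.

Lemma ler_normcB (x y z : C) : normc (x - z) <= normc (x - y) + normc (y - z).
Proof. by rewrite -{1}[x](subrK y) -addrA le_normcD. Qed.

Lemma lerB_normc (x y : C) : normc x - normc y <= normc (x - y).
Proof. by rewrite lerBlDr -{1}[x](subrK y) le_normcD. Qed.

(** Complex differentiability as a first-order expansion, with real tolerances and the real-valued
    modulus [normc]. There is no quotient, so w = z needs no exclusion, and the estimates are
    inequalities between reals. *)
Definition cder (f : C -> C) (z d : C) := forall e : R, 0 < e ->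
  exists2 r : R, 0 < r & forall w, normc (w - z) < r ->
    normc (f w - f z - d * (w - z)) <= e * normc (w - z).

(** The field is left general because the expansion serves both for R[i] and, in the calculus of the
    exponential, for R. *)
Lemma derivable_dist (K : numFieldType) (f : K^o -> K^o) (z : K^o) :
  derivable f z 1 -> forall e : K, 0 < e -> exists2 r : K, 0 < r &
    forall w : K, `|w - z| < r ->
    `|f w - f z - ('D_1 f z : K) * (w - z)| <= e * `|w - z|.
Proof.
move=> fd e e0; have /cvgrPdist_le/(_ _ e0) := fd.
rewrite near_withinE => -[r/= r0 H]; exists r => // w wr.
have [->|wz] := eqVneq w z; first by rewrite !subrr mulr0 subrr normr0 mulr0.
have wz0 : w - z != 0 by rewrite subr_eq0.
have := H (w - z).
rewrite /= sub0r normrN => /(_ wr wz0).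
rewrite [_ *: 1]mulr1 subrK -[lim _]/('D_1 f z) => {}H.
have -> : f w - f z - ('D_1 f z : K) * (w - z) =
   - (('D_1 f z : K) - (w - z)^-1 * (f w - f z)) * (w - z).
  by rewrite opprB mulrBl mulrAC mulVf// mul1r.
by rewrite normrM normrN ler_wpM2r.
Qed.

Lemma derivable_cder (f : C -> C) (z : C) :
  derivable (f : Cplane R -> Cplane R) z 1 -> exists d, cder f z d.
Proof.
move=> fd; exists ('D_1 (f : Cplane R -> Cplane R) z) => e e0.
have [|r r0 H] := @derivable_dist _ f z fd e%:C; first by rewrite ltcR.
have rE : r = (Re r)%:C by rewrite RRe_real// gtr0_real.
exists (Re r); first by rewrite -ltcR -rE.
move=> w wr; rewrite -lecR rmorphM; apply: H.
by rewrite norm_normc rE ltcR.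
Qed.

Lemma cder_cst (c z : C) : cder (fun=> c) z 0.
Proof.
move=> e e0; exists 1 => // w _.
by rewrite subrr mul0r subr0 normc0 mulr_ge0 ?normc_ge0// ltW.
Qed.

Lemma cder_id (z : C) : cder id z 1.
Proof.
move=> e e0; exists 1 => // w _.
by rewrite mul1r subrr normc0 mulr_ge0 ?normc_ge0// ltW.
Qed.

Lemma cder_near (f g : C -> C) z d (r : R) : 0 < r ->
  (forall w, normc (w - z) < r -> f w = g w) -> cder f z d -> cder g z d.
Proof.
move=> r0 fg fd e e0; have [s s0 H] := fd e e0.
exists (Num.min r s); first by rewrite lt_min r0.
move=> w; rewrite lt_min => /andP[wr ws]; rewrite -!fg//; first exact: H.
by rewrite subrr normc0.
Qed.

Lemma cderD (f g : C -> C) z a b :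
  cder f z a -> cder g z b -> cder (fun w => f w + g w) z (a + b).
Proof.
move=> fd gd e e0; have e2 : 0 < e / 2 by rewrite divr_gt0.
have [r r0 fr] := fd _ e2; have [s s0 gs] := gd _ e2.
exists (Num.min r s) => [|w]; first by rewrite lt_min r0.
rewrite lt_min => /andP[/fr h1 /gs h2].
rewrite [X in normc X <= _](_ : _ = (f w - f z - a * (w - z))
  + (g w - g z - b * (w - z))); last by ring.
by rewrite (le_trans (le_normcD _ _))//; move: h1 h2; lra.
Qed.

Lemma cder_lip (f : C -> C) z d : cder f z d ->
  exists2 r : R, 0 < r & forall w, normc (w - z) < r ->
    normc (f w - f z) <= (normc d + 1) * normc (w - z).
Proof.
move=> /(_ 1 ltr01)[r r0 H]; exists r => // w /H h.
rewrite -[f w - f z](subrK (d * (w - z))) (le_trans (le_normcD _ _))//.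
by rewrite normcM; lra.
Qed.

Lemma cder_cts (f : C -> C) z d : cder f z d ->
  forall e : R, 0 < e -> exists2 r : R, 0 < r & forall w, normc (w - z) < r ->
    normc (f w - f z) <= e.
Proof.
move=> /cder_lip[r r0 H] e e0; have d0 : 0 < normc d + 1.
  by have := normc_ge0 d; lra.
exists (Num.min r (e / (normc d + 1))); first by rewrite lt_min r0 divr_gt0.
move=> w; rewrite lt_min => /andP[/H h]; rewrite ltr_pdivlMr// => /ltW h'.
by rewrite (le_trans h)// mulrC.
Qed.

Lemma cderM (f g : C -> C) z a b : cder f z a -> cder g z b ->
  cder (fun w => f w * g w) z (a * g z + f z * b).
Proof.
move=> fd gd e e0.
have G0 : 0 < normc (g z) + 1 by have := normc_ge0 (g z); lra.
have F0 : 0 < normc (f z) + 1 by have := normc_ge0 (f z); lra.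
have B0 : 0 < normc b + 1 by have := normc_ge0 b; lra.
have e3 : 0 < e / 3 by rewrite divr_gt0.
have [r1 r10 h1] := fd _ (divr_gt0 e3 G0).
have [r2 r20 h2] := gd _ (divr_gt0 e3 F0).
have [r3 r30 h3] := cder_cts fd (divr_gt0 e3 B0).
have [r4 r40 h4] := cder_lip gd.
exists (Num.min (Num.min r1 r2) (Num.min r3 r4)); first by rewrite !lt_min r10 r20 r30.
move=> w; rewrite !lt_min => /andP[/andP[/h1 {}h1 /h2 {}h2] /andP[/h3 {}h3 /h4 {}h4]].
rewrite [X in normc X <= _](_ : _ = (f w - f z - a * (w - z)) * g z
    + f z * (g w - g z - b * (w - z))
    + (f w - f z) * (g w - g z)); last by ring.
rewrite (le_trans (le_normcD _ _))// (le_trans (lerD (le_normcD _ _) (lexx _)))//.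
rewrite !normcM.
have t1 : normc (f w - f z - a * (w - z)) * normc (g z) <= e / 3 * normc (w - z).
  apply: le_trans (_ : e / 3 / (normc (g z) + 1) * normc (w - z) * (normc (g z) + 1) <= _).
    by rewrite ler_pM ?normc_ge0//; lra.
  by rewrite mulrAC divfK// gt_eqF.
have t2 : normc (f z) * normc (g w - g z - b * (w - z)) <= e / 3 * normc (w - z).
  apply: le_trans (_ : (normc (f z) + 1) * (e / 3 / (normc (f z) + 1) * normc (w - z)) <= _).
    by rewrite ler_pM ?normc_ge0//; lra.
  by rewrite mulrA [_ * (_ / _)]mulrC divfK// gt_eqF.
have t3 : normc (f w - f z) * normc (g w - g z) <= e / 3 * normc (w - z).
  apply: le_trans (_ : e / 3 / (normc b + 1) * ((normc b + 1) * normc (w - z)) <= _).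
    by rewrite ler_pM ?normc_ge0.
  by rewrite mulrA divfK// gt_eqF.
lra.
Qed.

Lemma cder_comp (f g : C -> C) z a b : cder f z a -> cder g (f z) b ->
  cder (fun w => g (f w)) z (b * a).
Proof.
move=> fd gd e e0.
have A0 : 0 < normc a + 1 by have := normc_ge0 a; lra.
have B0 : 0 < normc b + 1 by have := normc_ge0 b; lra.
have e2 : 0 < e / 2 by rewrite divr_gt0.
have [r1 r10 h1] := fd _ (divr_gt0 e2 B0).
have [r2 r20 h2] := gd _ (divr_gt0 e2 A0).
have r22 : 0 < r2 / 2 by rewrite divr_gt0.
have [r3 r30 h3] := cder_cts fd r22.
have [r4 r40 h4] := cder_lip fd.
exists (Num.min (Num.min r1 r3) r4); first by rewrite !lt_min r10 r30.
move=> w; rewrite !lt_min => /andP[/andP[/h1 {}h1 /h3 {}h3] /h4 {}h4].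
have {}h2 : normc (g (f w) - g (f z) - b * (f w - f z)) <=
     e / 2 / (normc a + 1) * normc (f w - f z) by apply: h2; lra.
rewrite [X in normc X <= _](_ : _ = (g (f w) - g (f z) - b * (f w - f z))
  + b * (f w - f z - a * (w - z))); last by ring.
rewrite (le_trans (le_normcD _ _))// normcM.
have t1 : e / 2 / (normc a + 1) * normc (f w - f z) <= e / 2 * normc (w - z).
  apply: le_trans (_ : e / 2 / (normc a + 1) * ((normc a + 1) * normc (w - z)) <= _).
    by rewrite ler_wpM2l// divr_ge0// ltW.
  by rewrite mulrA divfK// gt_eqF.
have t2 : normc b * normc (f w - f z - a * (w - z)) <= e / 2 * normc (w - z).
  apply: le_trans (_ : (normc b + 1) * (e / 2 / (normc b + 1) * normc (w - z)) <= _).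
    by rewrite ler_pM ?normc_ge0//; lra.
  by rewrite mulrA [_ * (_ / _)]mulrC divfK// gt_eqF.
lra.
Qed.

Lemma cderV (z : C) : z != 0 -> cder (fun w => w^-1) z (- (z^-1 ^+ 2)).
Proof.
move=> z0 e e0; have nz : 0 < normc z by rewrite normc_gt0.
(* The remainder is (w - z)^2 / (z^2 w). The first bound gives |w| >= |z|/2, and the second then
   makes |w - z| / |z^2 w| at most e. *)
pose r := Num.min (normc z / 2) (e * normc z ^+ 3 / 2).
exists r; first by rewrite lt_min !divr_gt0// mulr_gt0// exprn_gt0.
move=> w; rewrite lt_min => /andP[wr1 wr2].
have wn : normc z / 2 <= normc w.
  by have := lerB_normc z w; rewrite normcB; lra.
have w0 : w != 0 by rewrite -normc_gt0; apply: lt_le_trans wn; rewrite divr_gt0.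
rewrite [X in normc X <= _](_ : _ = (w - z) * ((w - z) * (z * z * w)^-1)); last first.
  by field; apply/andP.
rewrite normcM mulrC ler_wpM2r ?normc_ge0//.
rewrite normcM normcV !normcM ler_pdivrMr ?mulr_gt0 ?normc_gt0//.
have : e * normc z ^+ 2 * (normc z / 2) <= e * normc z ^+ 2 * normc w.
  by rewrite ler_wpM2l// mulr_ge0 ?ltW// exprn_gt0.
move: wr2; move: (normc z) (normc w) (normc (w - z)) => x y t; lra.
Qed.

Lemma cder_is_derive (V : normedModType R) (u : V -> R) (p v : V) (d : R) :
  (forall e, 0 < e -> exists2 r, 0 < r & forall t : R, `|t| < r ->
     `|u (t *: v + p) - u p - d * t| <= e * `|t|) -> is_derive p v u d.
Proof.
move=> H.
have L : (fun h : R => h^-1 *: ((u \o shift p) (h *: v) - u p)) @ 0^' --> d.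
  apply/cvgrPdist_le => e e0; have [r r0 hr] := H e e0.
  rewrite near_withinE; exists r => //= t /=; rewrite sub0r normrN => tr t0.
  have := hr t tr.
  rewrite (_ : u (t *: v + p) - u p - d * t = - (d - t^-1 * (u (t *: v + p) - u p)) * t).
    by rewrite normrM normrN ler_pM2r// normr_gt0.
  by rewrite opprB mulrBl mulrAC mulVf// mul1r.
split; last by apply: cvg_lim => //.
by apply/cvg_ex; exists d.
Qed.

End ComplexCalculus.

(** * Goursat's theorem for rectangles *)

Section Goursat.
Variable R : realType.
Local Notation C := R[i].
Local Notation Re := complex.Re.
Local Notation Im := complex.Im.
Local Notation mu := (@lebesgue_measure R).

(** Continuity is two-sided even at a and b. The integrands provide this, since H below is
    differentiable in the full sense at every point of the closed strip. *)
Definition cts_on (a b : R) (f : R -> R) := forall t, a <= t <= b -> {for t, continuous f}.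

Definition itg (a b : R) (f : R -> R) := \int[mu]_(t in `[a, b]) f t.

Lemma cts_on_integrable a b f : cts_on a b f -> mu.-integrable `[a, b] (EFin \o f).
Proof.
move=> cf; apply: continuous_compact_integrable; first exact: segment_compact.
apply: continuous_in_subspaceT => t; rewrite inE/= in_itv/=; exact: cf.
Qed.

Lemma cts_onB a b f g : cts_on a b f -> cts_on a b g -> cts_on a b (fun t => f t - g t).
Proof. by move=> cf cg t h; apply: cvgB; [exact: cf|exact: cg]. Qed.

Lemma itg_split a b c f : a <= b -> b <= c -> cts_on a c f -> itg a c f = itg a b f + itg b c f.
Proof.
move=> ab bc cf; have iac := cts_on_integrable cf.
have ibc : mu.-integrable `]b, c] (EFin \o f).
  by apply: integrableS iac => //; apply: subset_itvr; rewrite bnd_simp.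
have := @Rintegral_itvB _ f (BLeft a) (BRight c) b iac.
rewrite !bnd_simp => /(_ ab bc); rewrite Rintegral_itv_obnd_cbnd// /itg => <-.
by rewrite addrC subrK.
Qed.

Lemma itgB a b f g : cts_on a b f -> cts_on a b g ->
  itg a b (fun t => f t - g t) = itg a b f - itg a b g.
Proof. by move=> cf cg; apply: RintegralB => //; exact: cts_on_integrable. Qed.

Lemma itgZ a b k f : cts_on a b f -> itg a b (fun t => k * f t) = k * itg a b f.
Proof. by move=> cf; apply: RintegralZl => //; exact: cts_on_integrable. Qed.

Lemma itgN a b f : cts_on a b f -> itg a b (fun t => - f t) = - itg a b f.
Proof.
move=> cf; rewrite -mulN1r -(itgZ (-1) cf); congr (itg a b _).
by apply/funext => t; rewrite mulN1r.
Qed.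

Lemma itg_cst a b c : a <= b -> itg a b (fun=> c) = c * (b - a).
Proof.
move=> ab; rewrite /itg Rintegral_cst//= lebesgue_measure_itv/= lte_fin.
by case: ltgtP ab => //= -> _; rewrite subrr.
Qed.

Lemma itg_le a b f g : cts_on a b f -> cts_on a b g ->
  (forall t, a <= t <= b -> f t <= g t) -> itg a b f <= itg a b g.
Proof.
move=> cf cg fg; apply: le_Rintegral => //; try exact: cts_on_integrable.
Qed.

Lemma cts_on_cst a b c : cts_on a b (fun=> c).
Proof. by move=> t _; exact: cvg_cst. Qed.

Lemma itg_dist a b f c M : a <= b -> cts_on a b f ->
  (forall t, a <= t <= b -> `|f t - c| <= M) -> `|itg a b f - c * (b - a)| <= M * (b - a).
Proof.
move=> ab cf fM; rewrite ler_distl -mulrBl -mulrDl -!itg_cst//.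
by apply/andP; split; apply: itg_le => //; try exact: cts_on_cst;
  move=> t /fM; rewrite ler_distl => /andP[].
Qed.

Lemma nested_point (x l : R^nat) : (forall n, x n <= x n.+1) -> (forall n, 0 <= l n) ->
  (forall n, x n.+1 + l n.+1 <= x n + l n) -> exists a, forall n, x n <= a <= x n + l n.
Proof.
move=> x1 l0 x2.
have xm n k : x n <= x (n + k)%N.
  by elim: k => [|k IH]; rewrite ?addn0// addnS (le_trans IH).
have ym n k : x (n + k)%N + l (n + k)%N <= x n + l n.
  by elim: k => [|k IH]; rewrite ?addn0// addnS (le_trans _ IH).
have xy n m : x n <= x m + l m.
  have [nm|mn] := leqP n m.
    have := xm n (m - n)%N; rewrite subnKC// => h; have := l0 m; lra.
  by have := ym m (n - m)%N; rewrite subnKC 1?ltnW// => h; have := l0 n; lra.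
have sx : has_sup (range x).
  by split; [exists (x 0%N), 0%N|exists (x 0%N + l 0%N) => _ [n _ <-]].
exists (sup (range x)) => n; apply/andP; split.
  by apply: ub_le_sup; [exact: (proj2 sx)|exists n].
by apply: ge_sup; [exact: (proj1 sx)|move=> _ [m _ <-]].
Qed.

Variables (H : C -> C) (a0 b0 : R).
Hypothesis Hd : forall z, a0 <= Re z <= b0 -> exists d, cder H z d.

Let U x y := Im (H (x +i* y)).
Let V x y := Re (H (x +i* y)).

(** The factor w selects the part of H: w = 1 gives the real part and w = -i the imaginary part. *)
Lemma cts_line (w v z : C) (t : R) : (exists d, cder H (z + v * t%:C) d) ->
  {for t, continuous (fun t : R => Re (w * H (z + v * t%:C)))}.
Proof.
move=> [d Hz]; have wH := cderM (cder_cst w _) Hz.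
apply/cvgrPdist_le => e e0.
have [r r0 hr] := cder_cts wH e0.
have v0 : 0 < normc v + 1 by have := normc_ge0 v; lra.
exists (r / (normc v + 1)) => /=; first by rewrite divr_gt0.
move=> s /=; rewrite ltr_pdivlMr// distrC => ts.
apply: le_trans (hr (z + v * s%:C) _); last first.
  rewrite opprD addrACA subrr add0r -mulrBr -rmorphB normcM normc_real.
  by apply: le_lt_trans ts; rewrite mulrC ler_wpM2l//; lra.
by rewrite distrC -raddfB; exact: normc_Re.
Qed.

Lemma cts_U1 y a b : a0 <= a -> b <= b0 -> cts_on a b (fun t => U t y).
Proof.
move=> ha hb t /andP[h1 h2].
have -> : (fun t => U t y) = (fun t : R => Re (- 'i * H ((0 +i* y) + 1 * t%:C))).
  apply/funext => s; rewrite /U mul1r (_ : _ + _ = s +i* y); last by simpc.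
  by case: (H _) => u v; simpc.
by apply: cts_line; apply: Hd; simpc => /=; apply/andP; split; lra.
Qed.

Lemma cts_V2 x c d : a0 <= x <= b0 -> cts_on c d (fun t => V x t).
Proof.
move=> hx t _.
have -> : (fun t => V x t) = (fun t : R => Re (1 * H ((x +i* 0) + 'i * t%:C))).
  by apply/funext => s; rewrite /V mul1r (_ : _ + _ = x +i* s)//; simpc.
by apply: cts_line; apply: Hd; simpc => /=.
Qed.

(** The imaginary part of the integral of H dz, counterclockwise around the rectangle with lower
    left corner x + iy and sides l and m. On vertical sides it integrates Re H, the quantity whose
    circular means are wanted. *)
Let J x y l m := itg x (x + l) (fun t => U t y - U t (y + m)) +
                 itg y (y + m) (fun t => V (x + l) t - V x t).

Lemma J_split x y l m : 0 <= l -> 0 <= m -> a0 <= x -> x + (l + l) <= b0 ->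
  J x y (l + l) (m + m) = J x y l m + J (x + l) y l m + J x (y + m) l m + J (x + l) (y + m) l m.
Proof.
move=> l0 m0 ax xb; rewrite /J !addrA.
have cU c a b : a0 <= a -> b <= b0 -> cts_on a b (fun t => U t c) by exact: cts_U1.
have cV a c d : a0 <= a -> a <= b0 -> cts_on c d (fun t => V a t).
  by move=> ? ?; apply: cts_V2; apply/andP.
rewrite !itgB; try (by apply: cU; lra); try (by apply: cV; lra).
rewrite (@itg_split x (x + l) (x + l + l)); [|lra|lra|by apply: cU; lra].
rewrite (@itg_split x (x + l) (x + l + l)); [|lra|lra|by apply: cU; lra].
rewrite (@itg_split y (y + m) (y + m + m)); [|lra|lra|by apply: cV; lra].
rewrite (@itg_split y (y + m) (y + m + m)); [|lra|lra|by apply: cV; lra].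
ring.
Qed.

(** The affine part of H at a + ib contributes - Re(d) m l on the horizontal sides and Re(d) l m on
    the vertical ones, which cancel. The remainder, at most (e/2)(l + m) on each side, gives e (l +
    m) l + e (l + m) m. *)
Lemma J_small (a b : R) : a0 <= a <= b0 -> forall e, 0 < e -> exists2 r, 0 < r &
  forall x y l m, 0 <= l -> 0 <= m -> a0 <= x -> x + l <= b0 ->
  x <= a <= x + l -> y <= b <= y + m ->
  l + m < r -> `|J x y l m| <= e * (l + m) ^+ 2.
Proof.
move=> hab e e0; have [|d Hz] := Hd (z := a +i* b); first by [].
have e2 : 0 < e / 2 by rewrite divr_gt0.
have [r r0 hr] := Hz _ e2; exists r => // x y l m l0 m0 ax xb /andP[xa ax'] /andP[yb yb'] lmr.
have E s t : x <= s <= x + l -> y <= t <= y + m ->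
   normc (H (s +i* t) - H (a +i* b) - d * ((s - a) +i* (t - b))) <= e / 2 * (l + m).
  move=> /andP[h1 h2] /andP[h3 h4].
  have N : normc ((s - a) +i* (t - b)) <= l + m.
    rewrite (le_trans (normc_ReIm _))//= lerD// ler_norml; apply/andP; split; lra.
  have := hr (s +i* t); rewrite (_ : s +i* t - (a +i* b) = (s - a) +i* (t - b)); last by simpc.
  move=> /(_ (le_lt_trans N lmr)) /le_trans; apply; rewrite ler_wpM2l// ltW//.
have EU s t : x <= s <= x + l -> y <= t <= y + m ->
   `|U s t - (Im (H (a +i* b)) + (Re d * (t - b) + Im d * (s - a)))| <= e / 2 * (l + m).
  move=> hs ht; apply: le_trans (E s t hs ht).
  rewrite (_ : _ - _ = Im (H (s +i* t) - H (a +i* b) - d * ((s - a) +i* (t - b)))).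
    exact: normc_Im.
  by rewrite /U; case: (H _) => ? ?; case: (H _) => ? ?; case: (d) => ? ? /=; ring.
have EV s t : x <= s <= x + l -> y <= t <= y + m ->
   `|V s t - (Re (H (a +i* b)) + (Re d * (s - a) - Im d * (t - b)))| <= e / 2 * (l + m).
  move=> hs ht; apply: le_trans (E s t hs ht).
  rewrite (_ : _ - _ = Re (H (s +i* t) - H (a +i* b) - d * ((s - a) +i* (t - b)))).
    exact: normc_Re.
  by rewrite /V; case: (H _) => ? ?; case: (H _) => ? ?; case: (d) => ? ? /=; ring.
have hx0 : x <= x <= x + l by apply/andP; split; lra.
have hx1 : x <= x + l <= x + l by apply/andP; split; lra.
have hy0 : y <= y <= y + m by apply/andP; split; lra.
have hy1 : y <= y + m <= y + m by apply/andP; split; lra.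
have B1 : `|itg x (x + l) (fun t => U t y - U t (y + m)) - (- (Re d * m)) * (x + l - x)| <=
    e * (l + m) * (x + l - x).
  apply: itg_dist; first by lra.
    by apply: cts_onB; apply: cts_U1; lra.
  move=> t ht; have := EU t _ ht hy0; have := EU t _ ht hy1.
  by rewrite !ler_norml => /andP[? ?] /andP[? ?]; apply/andP; split; lra.
have B2 : `|itg y (y + m) (fun t => V (x + l) t - V x t) - (Re d * l) * (y + m - y)| <=
    e * (l + m) * (y + m - y).
  apply: itg_dist; first by lra.
    by apply: cts_onB; apply: cts_V2; apply/andP; split; lra.
  move=> t ht; have := EV _ t hx0 ht; have := EV _ t hx1 ht.
  by rewrite !ler_norml => /andP[? ?] /andP[? ?]; apply/andP; split; lra.
move: B1 B2; rewrite /J !ler_norml => /andP[? ?] /andP[? ?]; apply/andP; split; lra.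
Qed.

(** Repeated quartering: some quarter keeps at least a quarter of |J|, and the chosen rectangles
    shrink to a point. There [J_small] gives e (l0 + m0)^2 / 4^n, which exactly offsets the factor
    4^n lost on the way. *)
Theorem goursat x0 y0 l0 m0 : 0 <= l0 -> 0 <= m0 -> a0 <= x0 -> x0 + l0 <= b0 ->
  J x0 y0 l0 m0 = 0.
Proof.
move=> l00 m00 ax xb.
pose l n : R := l0 / 2 ^+ n; pose m n : R := m0 / 2 ^+ n.
have p2 n : 0 < 2 ^+ n :> R by rewrite exprn_gt0.
have l_ge0 n : 0 <= l n by rewrite divr_ge0// ltW.
have m_ge0 n : 0 <= m n by rewrite divr_ge0// ltW.
have lS n : l n = l n.+1 + l n.+1.
  by rewrite /l exprS; field; rewrite gt_eqF.
have mS n : m n = m n.+1 + m n.+1.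
  by rewrite /m exprS; field; rewrite gt_eqF.
pose ok n (p q : R * R) := `|J p.1 p.2 (l n) (m n)| <= 4 * `|J q.1 q.2 (l n.+1) (m n.+1)|.
(* The last quarter is the default choice: if the other three fail, the triangle inequality forces
   it to qualify. *)
pose step n (p : R * R) : R * R :=
  if ok n p p then p else
  if ok n p (p.1 + l n.+1, p.2) then (p.1 + l n.+1, p.2) else
  if ok n p (p.1, p.2 + m n.+1) then (p.1, p.2 + m n.+1) else
  (p.1 + l n.+1, p.2 + m n.+1).
have stepP n p : a0 <= p.1 -> p.1 + l n <= b0 -> [/\ ok n p (step n p),
   p.1 <= (step n p).1 <= p.1 + l n.+1 & p.2 <= (step n p).2 <= p.2 + m n.+1].
  move=> h1 h2; have ln := l_ge0 n.+1; have mn := m_ge0 n.+1; rewrite /step.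
  case: ifPn => [->|n1]; first by split => //; apply/andP; split; lra.
  case: ifPn => [->|n2]; first by split => //=; apply/andP; split; lra.
  case: ifPn => [->|n3]; first by split => //=; apply/andP; split; lra.
  split => /=; [|by apply/andP; split; lra|by apply/andP; split; lra].
  have JS : J p.1 p.2 (l n) (m n) = J p.1 p.2 (l n.+1) (m n.+1) +
      J (p.1 + l n.+1) p.2 (l n.+1) (m n.+1) + J p.1 (p.2 + m n.+1) (l n.+1) (m n.+1) +
      J (p.1 + l n.+1) (p.2 + m n.+1) (l n.+1) (m n.+1).
    by rewrite (lS n) (mS n) J_split// -lS.
  move: n1 n2 n3; rewrite /ok /= -!ltNge JS => n1 n2 n3; move: n1 n2 n3.
  set A := J _ _ _ _; set B := J _ _ _ _; set D := J _ _ _ _; set E := J _ _ _ _.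
  have := ler_normD (A + B + D) E; have := ler_normD (A + B) D; have := ler_normD A B.
  lra.
pose s := fix s n : R * R := if n is k.+1 then step k (s k) else (x0, y0).
have sP n : [/\ a0 <= (s n).1, (s n).1 + l n <= b0 &
  `|J x0 y0 l0 m0| <= 4 ^+ n * `|J (s n).1 (s n).2 (l n) (m n)|].
  elim: n => [|n [h1 h2 h3]]; first by rewrite /l /m !expr0 !divr1 mul1r.
  have [hk /andP[k1 k2] _] := stepP n (s n) h1 h2.
  split => /=; [lra|have := lS n; lra|].
  rewrite (le_trans h3)// exprSr -mulrA ler_wpM2l// exprn_ge0//.
have sS n : (s n).1 <= (s n.+1).1 <= (s n).1 + l n.+1 /\
            (s n).2 <= (s n.+1).2 <= (s n).2 + m n.+1.
  by have [h1 h2 _] := sP n; have [] := stepP n (s n) h1 h2.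
have [a ha] : exists a, forall n, (s n).1 <= a <= (s n).1 + l n.
  apply: (@nested_point (fun n => (s n).1) l) => // n.
    by have [/andP[]] := sS n.
  by have [/andP[_ ?] _] := sS n; have := lS n; lra.
have [b hb] : exists b, forall n, (s n).2 <= b <= (s n).2 + m n.
  apply: (@nested_point (fun n => (s n).2) m) => // n.
    by have [_ /andP[]] := sS n.
  by have [_ /andP[_ ?]] := sS n; have := mS n; lra.
have hab : a0 <= a <= b0.
  by have := ha 0%N => /= /andP[? ?]; have [/= ? ? _] := sP 0%N; apply/andP; split; lra.
have J0 e : 0 < e -> `|J x0 y0 l0 m0| <= e * (l0 + m0) ^+ 2.
  move=> e0; have [r r0 hr] := J_small b hab e0.
  have [n hn] : exists n, l n + m n < r.
    have [k lk] : exists k : nat, (l0 + m0) / r < k%:R.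
      by exists (Num.bound ((l0 + m0) / r)); rewrite archi_boundP// divr_ge0 ?addr_ge0// ltW.
    exists k; rewrite /l /m -mulrDl ltr_pdivrMr// mulrC -ltr_pdivrMr//.
    by apply: lt_trans lk _; rewrite -natrX ltr_nat ltn_expl.
  have [h1 h2 h3] := sP n; apply: le_trans h3 _.
  have := hr _ _ _ _ (l_ge0 n) (m_ge0 n) h1 h2 (ha n) (hb n) hn.
  rewrite -(ler_pM2l (_ : 0 < 4 ^+ n)) ?exprn_gt0// => /le_trans; apply.
  rewrite le_eqVlt; apply/orP; left; apply/eqP; rewrite /l /m.
  have -> : 4 ^+ n = 2 ^+ n * 2 ^+ n :> R by rewrite -exprMn; congr (_ ^+ _); ring.
  by field; rewrite gt_eqF.
apply/eqP; rewrite -normr_le0; apply/ler_addgt0Pr => e e0; rewrite add0r.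
have S0 : 0 < (l0 + m0) ^+ 2 + 1 by have := sqr_ge0 (l0 + m0); lra.
apply: le_trans (J0 _ (divr_gt0 e0 S0)) _.
by rewrite mulrAC ler_pdivrMr// ler_pM2l//; lra.
Qed.

End Goursat.

(** * The complex exponential *)

Section Cexp.
Variable R : realType.
Local Notation C := R[i].
Local Notation Re := complex.Re.
Local Notation Im := complex.Im.

Definition cexp (z : C) : C := (expR (Re z) * cos (Im z)) +i* (expR (Re z) * sin (Im z)).

Lemma cexpD z w : cexp (z + w) = cexp z * cexp w.
Proof.
case: z => a b; case: w => c d; rewrite /cexp/= expRD cosD sinD.
by apply/eqP; rewrite eq_complex /=; apply/andP; split; apply/eqP; ring.
Qed.

Lemma cexp0 : cexp 0 = 1.
Proof. by rewrite /cexp/= expR0 cos0 sin0 mulr0 mulr1. Qed.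

Lemma cexp_neq0 z : cexp z != 0.
Proof.
apply/eqP => z0; have := cexpD z (- z); rewrite z0 mul0r subrr cexp0 => /eqP.
by rewrite oner_eq0.
Qed.

Lemma cexpN z : cexp (- z) = (cexp z)^-1.
Proof.
apply: (mulfI (cexp_neq0 z)); rewrite -cexpD subrr cexp0 divff//; exact: cexp_neq0.
Qed.

Lemma normc_cexp z : normc (cexp z) = expR (Re z).
Proof.
by rewrite /cexp /= !exprMn -mulrDr cos2Dsin2 mulr1 sqrtr_sqr ger0_norm ?expR_ge0.
Qed.

Lemma cexp_period x (y : R) : cexp (x +i* (y + pi *+ 2)) = cexp (x +i* y).
Proof. by rewrite /cexp /= cosD2pi sinD2pi. Qed.

Lemma real_expansion (f : R -> R) (d : R) : is_derive (0:R) 1 f d -> forall e, 0 < e ->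
  exists2 r : R, 0 < r & forall w, `|w| < r -> `|f w - f 0 - d * w| <= e * `|w|.
Proof.
move=> [fd <-] e e0; have [r r0 H] := @derivable_dist _ f 0 fd e e0.
by exists r => // w; have := H w; rewrite subr0.
Qed.

Lemma cder_cexp0 : cder cexp 0 1.
Proof.
(* The nine shares of e' |w| are 1 + 3 for the real part and 3 + 2 for the imaginary part. The bound
   e' <= 1 keeps exp(Re w) below 3. *)
move=> e e0; have [e' [e'0 e1 e9]] : exists e' : R, [/\ 0 < e', e' <= 1 & e' <= e / 9].
  exists (Num.min 1 (e / 9)).
  by rewrite lt_min ltr01 divr_gt0// !ge_min !lexx orbT.
have [r1 r10 h1] := real_expansion (is_derive_expR 0) e'0.
have [r2 r20 h2] := real_expansion (is_derive_cos 0) e'0.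
have [r3 r30 h3] := real_expansion (is_derive_sin 0) e'0.
exists (Num.min (Num.min r1 r2) (Num.min r3 e')); first by rewrite !lt_min r10 r20 r30 e'0.
move=> w; rewrite !lt_min subr0 => /andP[/andP[w1 w2] /andP[w3 w4]].
rewrite cexp0 mul1r; have := normc_Re w; have := normc_Im w => hb ha.
have {}h1 := h1 _ (le_lt_trans ha w1); have {}h2 := h2 _ (le_lt_trans hb w2).
have {}h3 := h3 _ (le_lt_trans hb w3).
move: h1 h2 h3; rewrite expR0 cos0 sin0 oppr0 mul0r ?oppr0 ?subr0 ?addr0 !mul1r => h1 h2 h3.
rewrite (le_trans (normc_ReIm _))//.
have -> : Re (cexp w - 1 - w) = expR (Re w) * cos (Im w) - 1 - Re w by case: (w).
have -> : Im (cexp w - 1 - w) = expR (Re w) * sin (Im w) - Im w.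
  by case: (w) => ? ? /=; rewrite subr0.
have n0 := normc_ge0 w; have e'0' := ltW e'0.
move: ha hb w4 n0 h1 h2 h3; set a := Re w; set b := Im w; set n := normc w => ha hb w4 n0.
set E := expR a; set c := cos b; set s := sin b => h1 h2 h3.
have h1n : `|E - 1 - a| <= e' * n by rewrite (le_trans h1)// ler_wpM2l.
have h2n : `|c - 1| <= e' * n by rewrite (le_trans h2)// ler_wpM2l.
have h3n : `|s - b| <= e' * n by rewrite (le_trans h3)// ler_wpM2l.
have e'n : e' * n <= e' by rewrite ler_piMr//; lra.
have Ea : `|E - 1| <= 2 * e'.
  have := ler_normD (E - 1 - a) a; rewrite subrK; lra.
have E3 : `|E| <= 3.
  by have := ler_normD (E - 1) 1; rewrite subrK normr1; lra.
have t1 : `|E * (c - 1)| <= 3 * (e' * n) by rewrite normrM ler_pM.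
have t2 : `|E * (s - b)| <= 3 * (e' * n) by rewrite normrM ler_pM.
have t3 : `|(E - 1) * b| <= 2 * e' * n by rewrite normrM ler_pM.
have -> : E * c - 1 - a = (E - 1 - a) + E * (c - 1) by ring.
have -> : E * s - b = E * (s - b) + (E - 1) * b by ring.
have := ler_normD (E - 1 - a) (E * (c - 1)).
have := ler_normD (E * (s - b)) ((E - 1) * b).
have : 9 * e' * n <= e * n by rewrite ler_wpM2r//; lra.
lra.
Qed.

Lemma cder_cexp z : cder cexp z (cexp z).
Proof.
have sh : cder (fun w => w - z) z 1.
  by have := cderD (cder_id z) (cder_cst (- z) z); rewrite addr0.
have ed : cder cexp (z - z) 1 by rewrite subrr; exact: cder_cexp0.
have := cderM (cder_cst (cexp z) z) (cder_comp sh ed).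
rewrite mul0r add0r !mulr1.
by apply: cder_near (ltr01) _ => w _; rewrite -cexpD addrCA subrr addr0.
Qed.

End Cexp.

(** * Holomorphic functions with nonnegative real part *)

Section Herglotz.
Variable R : realType.
Local Notation C := R[i].
Local Notation Re := complex.Re.
Local Notation Im := complex.Im.

(** Goursat's theorem on the rectangle with sides [a, 0] and [0, 2 pi]: the horizontal sides cancel
    by periodicity. Under z = s exp(w) the two vertical sides are the circles of radii s exp(a) and
    s. *)
Lemma circle_mean (H : C -> C) (a : R) : a <= 0 ->
  (forall z, a <= Re z <= 0 -> exists d, cder H z d) ->
  (forall x y, H (x +i* (y + pi *+ 2)) = H (x +i* y)) ->
  itg 0 (pi *+ 2) (fun t => Re (H (a +i* t))) = itg 0 (pi *+ 2) (fun t => Re (H (0 +i* t))).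
Proof.
move=> a0 Hd Hp; have p0 : 0 <= pi *+ 2 :> R by rewrite mulrn_wge0// pi_ge0.
have := goursat Hd 0 (_ : 0 <= - a) p0 (lexx a).
rewrite subrr oppr_ge0 => /(_ a0 (lexx 0)); rewrite add0r => G.
have ca t : (a <= t <= 0) -> forall c d, cts_on c d (fun u => Re (H (t +i* u))).
  by move=> h c d; exact: (@cts_V2 _ H a 0 Hd t c d).
move: G; rewrite (_ : itg a 0 _ = 0).
  rewrite itgB; [|by apply: ca; rewrite lexx a0|by apply: ca; rewrite lexx a0].
  by rewrite add0r => /eqP; rewrite subr_eq0 => /eqP.
transitivity (itg a 0 (fun=> 0)); last by rewrite itg_cst// mul0r.
apply: eq_Rintegral => t _.
by rewrite -[in X in _ - X](add0r (pi *+ 2)) Hp subrr.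
Qed.

Lemma expR_small (e : R) : 0 < e -> exists2 L, 0 < L & expR (- L) < e.
Proof.
move=> e0; exists e^-1; first by rewrite invr_gt0.
rewrite expRN -[ltRHS]invrK ltf_pV2 ?posrE ?expR_gt0 ?invr_gt0//.
by have := expR_ge1Dx e^-1; lra.
Qed.

Lemma cderN_id (z : C) : cder (fun w => - w) z (-1).
Proof.
have := cderM (cder_cst (-1) z) (cder_id z).
rewrite mul0r add0r mulr1; apply: cder_near ltr01 _ => w _.
by rewrite mulN1r.
Qed.

Lemma cder_cexpN z : exists d, cder (fun w => @cexp R (- w)) z d.
Proof. by eexists; apply: (cder_comp (cderN_id z)); exact: cder_cexp. Qed.

(** By [circle_mean] the integral is the same over Re = -L and Re = 0, yet the first is exp(L) times
    the second; hence both vanish. *)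
Lemma mean_expN (Q : C) (L : R) : 0 < L ->
  itg 0 (pi *+ 2) (fun t => Re (Q * cexp (- (- L +i* t)))) = 0.
Proof.
move=> L0; pose K w := Q * @cexp R (- w).
have Kd z : exists d, cder K z d.
  by have [d hd] := cder_cexpN z; eexists; exact: (cderM (cder_cst Q z) hd).
have Kp x y : K (x +i* (y + pi *+ 2)) = K (x +i* y).
  by rewrite /K !cexpN cexp_period.
have := @circle_mean K (- L) _ (fun z _ => Kd z) Kp.
rewrite oppr_le0 (ltW L0) => /(_ isT) E.
have cK t : cts_on 0 (pi *+ 2) (fun u => Re (K (t +i* u))).
  by apply: (@cts_V2 _ K t t (fun z _ => Kd z)); rewrite lexx.
have S : itg 0 (pi *+ 2) (fun t => Re (K (- L +i* t))) =
  expR L * itg 0 (pi *+ 2) (fun t => Re (K (0 +i* t))).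
  rewrite -(itgZ (expR L) (cK 0)).
  apply: eq_Rintegral => t _; rewrite /K.
  have -> : cexp (- (- L +i* t)) = (expR L)%:C * cexp (- (0 +i* t)).
    rewrite (_ : (- (- L +i* t)) = L%:C + - (0 +i* t)); last by simpc.
    by rewrite cexpD; congr (_ * _); rewrite /cexp/= cos0 sin0 mulr1 mulr0.
  by rewrite mulrCA; case: (Q * _) => u v; simpc.
have eL : 1 < expR L by rewrite expR_gt1.
move: E; rewrite S => E.
suff -> : itg 0 (pi *+ 2) (fun t => Re (K (0 +i* t))) = 0 by rewrite mulr0.
move: E; move: (itg _ _ _) => X E.
have : (expR L - 1) * X = 0 by rewrite mulrBl mul1r E subrr.
by move/eqP; rewrite mulf_eq0 subr_eq0 gt_eqF//= => /eqP.
Qed.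

Lemma ReD (a b : C) : Re (a + b) = Re a + Re b.
Proof. by case: a; case: b. Qed.

(** Here c = exp(w) is small and Fz = F(s c). The term 1/c of the weight is large: its product with
    the constant Q is compensated by adding Q/c, which has mean zero, and its product with d s c
    leaves s d. The errors are 2e from 2 (Fz - Q), and e each from the remainder divided by c and
    from Fz c. *)
Lemma first_order_bound (Fz Q d c : C) (s e : R) : 0 < s -> s <= 1 -> 0 < e -> c != 0 ->
  normc (Fz - Q - d * (s%:C * c)) <= e * normc (s%:C * c) ->
  normc (Fz - Q) <= e -> normc c * (normc Q + e) <= e ->
  Re (Fz * (2 - c^-1 - c) + Q * c^-1) <= 2 * Re Q - s * Re d + 4 * e.
Proof.
move=> s0 s1 e0 c0 h1 h2 h3.
have n0 : normc c != 0 by rewrite normc_eq0.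
have -> : Fz * (2 - c^-1 - c) + Q * c^-1 = (2%:C * Q - s%:C * d) +
    (2 * (Fz - Q) - c^-1 * (Fz - Q - d * (s%:C * c)) - Fz * c).
  by rewrite rmorph_nat; field.
rewrite ReD (_ : Re (2%:C * Q - s%:C * d) = 2 * Re Q - s * Re d); last first.
  by case: (Q) => ? ?; case: (d) => ? ?; simpc.
rewrite lerD2l; apply: le_trans (ler_norm _) _; apply: le_trans (normc_Re _) _.
apply: le_trans (le_normcD _ _) _; rewrite normcN.
apply: le_trans (lerD (le_normcD _ _) (lexx _)) _; rewrite normcN !normcM.
have -> : normc (2 : C) = 2 by rewrite -[2 in LHS](rmorph_nat (real_complex R)) normc_real ger0_norm.
have t2 : normc c^-1 * normc (Fz - Q - d * (s%:C * c)) <= e.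
  rewrite normcV; apply: le_trans (_ : (normc c)^-1 * (e * (s * normc c)) <= _).
    rewrite ler_wpM2l ?invr_ge0 ?normc_ge0//; move: h1.
    by rewrite normcM normc_real ger0_norm// ltW.
  have -> : (normc c)^-1 * (e * (s * normc c)) = e * s by field.
  by rewrite ler_piMr// ltW.
have t3 : normc Fz * normc c <= e.
  have := le_normcD (Fz - Q) Q; rewrite subrK => h.
  apply: le_trans h3; rewrite mulrC ler_wpM2l ?normc_ge0//.
  by apply: le_trans h _; rewrite addrC lerD2l.
lra.
Qed.

Lemma deriv_Re_bound (F : C -> C) (d : C) :
  (forall z, normc z < 1 -> exists d, cder F z d) ->
  (forall z, normc z < 1 -> 0 <= Re (F z)) ->
  cder F 0 d -> Re d <= 2 * Re (F 0).
Proof.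
move=> Fd Fre F0; set Q := F 0.
suff main (s e : R) : 0 < s -> s < 1 -> 0 < e -> s * Re d <= 2 * Re Q + 4 * e.
  have main0 s : 0 < s -> s < 1 -> s * Re d <= 2 * Re Q.
    move=> s0 s1; apply/ler_addgt0Pr => e e0.
    have e4 : 0 < e / 4 by rewrite divr_gt0.
    by have := main s (e / 4) s0 s1 e4; lra.
  have Q0 : 0 <= Re Q by apply: Fre; rewrite normc0.
  have [d0|d0] := leP (Re d) 0; first by lra.
  apply/ler_addgt0Pr => e e0.
  (* With this radius, Re d - s Re d = s e <= e. *)
  pose s := Re d / (Re d + e).
  have de : 0 < Re d + e by lra.
  have s0 : 0 < s by rewrite divr_gt0.
  have s1 : s < 1 by rewrite ltr_pdivrMr//; lra.
  have := main0 s s0 s1.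
  have : s * (Re d + e) = Re d by rewrite divfK// gt_eqF.
  have : s * e <= e by rewrite ler_piMl// ltW.
  lra.
move=> s0 s1 e0.
have pp0 : 0 < pi *+ 2 :> R by rewrite pmulrn_lgt0// pi_gt0.
pose H (w : C) := F (s%:C * cexp w) * (2 - cexp (- w) - cexp w).
have ns w : normc (s%:C * cexp w) = s * expR (Re w).
  by rewrite normcM normc_cexp normc_real ger0_norm// ltW.
have ns1 w : Re w <= 0 -> normc (s%:C * cexp w) < 1.
  move=> w0; rewrite ns; apply: le_lt_trans s1; rewrite ler_piMr//; first exact: ltW.
  by rewrite -expR0 ler_expR.
have Hd z : Re z <= 0 -> exists d, cder H z d.
  move=> z0; have [d1 h1] := Fd _ (ns1 z z0); have [d2 h2] := cder_cexpN z.
  have hs := cderM (cder_cst s%:C z) (cder_cexp z).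
  have h3 := cderM (cder_cst (-1) z) (cderD h2 (cder_cexp z)).
  have h4 := cderD (cder_cst 2 z) h3.
  eexists; apply: (cder_near ltr01 _ (cderM (cder_comp hs h1) h4)) => w _.
  by rewrite /H; congr (_ * _); ring.
have Hp x y : H (x +i* (y + pi *+ 2)) = H (x +i* y).
  by rewrite /H !cexpN cexp_period.
have q1 : 0 < normc Q + e by have := normc_ge0 Q; lra.
have [r1 r10 h1] := F0 _ e0.
have [r2 r20 h2] := cder_cts F0 e0.
(* The circle of radius s exp(-L) must lie where F is close to Q and to its first-order expansion,
   with exp(-L) (|Q| + e) <= e; these are the hypotheses of [first_order_bound]. *)
have [|L L0 LE] := @expR_small (Num.min (Num.min r1 r2) (e / (normc Q + e))).
  by rewrite !lt_min r10 r20 divr_gt0.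
move: LE; rewrite !lt_min => /andP[/andP[L1 L2]]; rewrite ltr_pdivlMr// => L3.
have cH a : a <= 0 -> cts_on 0 (pi *+ 2) (fun u => Re (H (a +i* u))).
  move=> a0; apply: (@cts_V2 _ H a a); last by rewrite lexx.
  by move=> z /andP[? ?]; apply: Hd; lra.
have L0' : - L <= 0 by lra.
have p0 : 0 <= pi *+ 2 :> R by rewrite mulrn_wge0// pi_ge0.
have M0 : 0 <= itg 0 (pi *+ 2) (fun t => Re (H (0 +i* t))).
  apply: Rintegral_ge0 => t _.
  have -> : H (0 +i* t) = F (s%:C * cexp (0 +i* t)) * (2 - 2 * cos t)%:C.
    rewrite /H /cexp/= oppr0 expR0 !mul1r cosN sinN; congr (_ * _).
    by apply/eqP; rewrite eq_complex/=; apply/andP; split; apply/eqP; ring.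
  have ReM (u : C) (x : R) : Re (u * x%:C) = Re u * x by case: u => ? ?; simpc.
  rewrite ReM.
  by apply: mulr_ge0; [apply/Fre/ns1|have := cos_le1 t; lra].
have E : itg 0 (pi *+ 2) (fun t => Re (H (- L +i* t))) =
  itg 0 (pi *+ 2) (fun t => Re (H (0 +i* t))).
  by apply: circle_mean => // z /andP[_ ?]; exact: Hd.
have cK t : cts_on 0 (pi *+ 2) (fun u => Re (Q * cexp (- (t +i* u)))).
  apply: (@cts_V2 _ (fun w => Q * cexp (- w)) t t); last by rewrite lexx.
  by move=> z _; have [d' hd] := cder_cexpN z; eexists; exact: (cderM (cder_cst Q z) hd).
(* The compensating term has mean zero by [mean_expN], so adding it leaves the integral
   unchanged. *)
have HK : itg 0 (pi *+ 2) (fun t => Re (H (- L +i* t)) - - Re (Q * cexp (- (- L +i* t)))) =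
    itg 0 (pi *+ 2) (fun t => Re (H (0 +i* t))).
  rewrite itgB; [|exact: cH|]; last first.
    by move=> t ht; apply: cvgN; exact: (cK (- L) t ht).
  by rewrite (itgN (cK (- L))) (mean_expN Q L0) oppr0 subr0.
move: M0; rewrite -HK => M0.
have {M0} : 0 <= (2 * Re Q - s * Re d + 4 * e) * (pi *+ 2 - 0).
  set K := 2 * Re Q - _ + _; rewrite -(@itg_cst R 0 (pi *+ 2) K p0).
  apply: (le_trans M0); apply: itg_le.
  - apply: cts_onB; first exact: cH.
    by move=> t ht; apply: cvgN; exact: (cK (- L) t ht).
  - exact: cts_on_cst.
  move=> t _; have nc : normc (cexp (- L +i* t)) = expR (- L) by rewrite normc_cexp.
  have nz : normc (s%:C * cexp (- L +i* t)) <= expR (- L).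
    by rewrite ns; exact: (ler_piMl (expR_ge0 _) (ltW s1)).
  rewrite opprK -ReD /H cexpN /K.
  apply: first_order_bound s0 (ltW s1) e0 (cexp_neq0 _) _ _ _.
  - by have := h1 (s%:C * cexp (- L +i* t)); rewrite subr0; apply; exact: le_lt_trans nz L1.
  - by have := h2 (s%:C * cexp (- L +i* t)); rewrite subr0; apply; exact: le_lt_trans nz L2.
  - by rewrite nc; exact: ltW L3.
by rewrite subr0 (pmulr_lge0 _ pp0) => h; clear -h; lra.
Qed.
End Herglotz.

(** * Growth estimates: Schwarz-Pick, Harnack and their integrated forms *)

Section Growth.
Variable R : realType.
Local Notation C := R[i].
Local Notation Re := complex.Re.
Local Notation Im := complex.Im.

Lemma mulc_conj (z : C) : z * conjc z = (normc z ^+ 2)%:C.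
Proof. by rewrite normc_sqr; case: z => a b; simpc; rewrite -!expr2 [b * a]mulrC addNr. Qed.

Definition disc_pos (F : C -> C) :=
  (forall z, normc z < 1 -> exists d, cder F z d) /\
  (forall z, normc z < 1 -> 0 <= Re (F z)).

(** This rotation turns bounds on real parts into bounds on moduli, here for derivatives and later
    for increments. *)
Lemma unit_dir (d : C) : exists2 u : C, normc u = 1 & u * d = (normc d)%:C.
Proof.
have [->|d0] := eqVneq d 0; first by exists 1; rewrite ?normc1// mulr0 normc0.
have n0 : normc d != 0 by rewrite normc_eq0.
exists (conjc d * (normc d)^-1%:C).
  by rewrite normcM normc_conj normc_real ger0_norm ?invr_ge0 ?normc_ge0// mulfV.
rewrite mulrAC [conjc d * d]mulrC mulc_conj -rmorphM; congr (_%:C).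
by rewrite expr2 mulfK.
Qed.

Lemma cder_scale (u z : C) : cder (fun w => u * w) z u.
Proof. by have := cderM (cder_cst u z) (cder_id z); rewrite mul0r add0r mulr1. Qed.

Lemma deriv_norm_bound (F : C -> C) (d : C) : disc_pos F -> cder F 0 d -> normc d <= 2 * Re (F 0).
Proof.
move=> [Fd Fre] F0; have [u u1 ud] := unit_dir d.
have nu z : normc z < 1 -> normc (u * z) < 1 by rewrite normcM u1 mul1r.
have := @deriv_Re_bound _ (fun z => F (u * z)) (d * u).
rewrite mulr0 [d * u]mulrC ud /=; apply.
- move=> z z1; have [e he] := Fd (u * z) (nu z z1).
  by eexists; apply: (cder_comp (cder_scale u z) he).
- by move=> z z1; exact: (Fre _ (nu z z1)).
- by rewrite -ud mulrC; apply: (cder_comp (cder_scale u 0)); rewrite mulr0.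
Qed.

Lemma moebius_disc (a z : C) : normc a < 1 -> normc z < 1 ->
  1 + conjc a * z != 0 /\ normc ((z + a) / (1 + conjc a * z)) < 1.
Proof.
move=> a1 z1.
have n1 : normc (conjc a * z) < 1.
  rewrite normcM normc_conj; apply: le_lt_trans z1.
  by rewrite ler_piMl ?normc_ge0// ltW.
have d0 : 1 + conjc a * z != 0.
  apply/eqP => h; have := lerB_normc (1 : C) (- (conjc a * z)).
  by rewrite opprK h normc0 normc1 normcN; lra.
split=> //; rewrite normcM normcV ltr_pdivrMr ?normc_gt0// mul1r.
rewrite -(@ltr_pXn2r _ 2) ?nnegrE ?normc_ge0// !normc_sqr.
(* This product equals |1 + conj(a) z|^2 - |z + a|^2. *)
have : 0 < (1 - normc a ^+ 2) * (1 - normc z ^+ 2).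
  by rewrite mulr_gt0// subr_gt0 expr_lt1 ?normc_ge0.
rewrite !normc_sqr; case: (a) => ? ?; case: (z) => ? ? /=; lra.
Qed.

(** The bound at 0, applied to F composed with the disc automorphism that sends 0 to a; that
    automorphism has derivative 1 - |a|^2 at 0. *)
Lemma schwarz_pick (F : C -> C) (a d : C) : disc_pos F -> normc a < 1 ->
  cder F a d -> normc d * (1 - normc a ^+ 2) <= 2 * Re (F a).
Proof.
move=> [Fd Fre] a1 hd; pose phi z := (z + a) / (1 + conjc a * z).
have phid z : normc z < 1 -> cder phi z
   (1 * (1 + conjc a * z)^-1 + (z + a) * (- ((1 + conjc a * z)^-1 ^+ 2) * conjc a)).
  move=> z1; have [dn0 _] := moebius_disc a1 z1.
  have h1 := cderD (cder_id z) (cder_cst a z).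
  have h2 := cderD (cder_cst 1 z) (cder_scale (conjc a) z).
  rewrite addr0 in h1; rewrite add0r in h2.
  exact: (cderM h1 (cder_comp h2 (cderV dn0))).
have phi0 : phi 0 = a by rewrite /phi mulr0 addr0 add0r divr1.
have dphi0 : cder phi 0 (1 - normc a ^+ 2)%:C.
  have := phid 0; rewrite normc0 ltr01 => /(_ isT).
  rewrite mulr0 addr0 add0r invr1 expr1n mulr1 mulN1r mulrN.
  by rewrite mulc_conj rmorphB rmorph1.
have := @deriv_norm_bound (fun z => F (phi z)) (d * (1 - normc a ^+ 2)%:C).
rewrite phi0 normcM normc_real ger0_norm; last first.
  by rewrite subr_ge0 expr_le1 ?normc_ge0// ltW.
apply; last by apply: cder_comp dphi0 _; rewrite phi0.
split=> z z1; have [_ pz] := moebius_disc a1 z1.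
  by have [e he] := Fd _ pz; eexists; apply: (cder_comp (phid z z1) he).
exact: (Fre _ pz).
Qed.

Lemma cder_line (c z v d : C) (f : C -> C) (t : R) : cder f (z + v * t%:C) d ->
  is_derive t 1 (fun t : R => Re (c * f (z + v * t%:C))) (Re (c * (d * v))).
Proof.
move=> hd; have := cderM (cder_cst c _) hd; rewrite mul0r add0r => hc.
apply: cder_is_derive => e e0.
have v0 : 0 < normc v + 1 by have := normc_ge0 v; lra.
have [r r0 hr] := hc _ (divr_gt0 e0 v0).
exists (r / (normc v + 1)) => [|s]; first by rewrite divr_gt0.
rewrite ltr_pdivlMr// => sr; rewrite [s *: 1]mulr1.
have N : normc (v * s%:C) <= `|s| * (normc v + 1).
  by rewrite normcM normc_real mulrC ler_wpM2l//; lra.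
have := hr (z + v * (s + t)%:C).
rewrite rmorphD mulrDr (_ : z + (v * s%:C + v * t%:C) - (z + v * t%:C) = v * s%:C); last by ring.
move=> /(_ (le_lt_trans N sr)) h.
apply: (@le_trans _ _ (e / (normc v + 1) * (`|s| * (normc v + 1)))); last first.
  by rewrite mulrCA divfK ?gt_eqF// mulrC.
apply: le_trans (_ : e / (normc v + 1) * normc (v * s%:C) <= _); last first.
  by rewrite ler_wpM2l// divr_ge0// ltW.
apply: le_trans h; apply: le_trans (normc_Re _).
rewrite le_eqVlt; apply/orP; left; apply/eqP; congr (`|_|).
case: (c * f _) => ? ?; case: (c * f _) => ? ?.
by case: (c) => ? ?; case: (d) => ? ?; case: (v) => ? ? /=; ring.
Qed.

Lemma nondecreasing01 (f f' : R -> R) : (forall t : R, 0 <= t <= 1 -> is_derive t 1 f (f' t)) ->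
  (forall t : R, 0 <= t <= 1 -> 0 <= f' t) -> f 0 <= f 1.
Proof.
move=> fd f0; have [||c c01 E] := @MVT_segment _ f f' 0 1 ler01.
- by move=> t; rewrite in_itv/= => /andP[? ?]; apply: fd; apply/andP; split; lra.
- apply: continuous_in_subspaceT => t; rewrite inE/= in_itv/= => ht.
  by apply: differentiable_continuous; apply/derivable1_diffP; have [] := fd t ht.
rewrite -subr_ge0 E; rewrite subr0 mulr1; apply: f0.
by move: c01; rewrite in_itv.
Qed.

Lemma is_derive_inv (s t : R) : 1 - t * s != 0 ->
  is_derive t 1 (fun t => (1 - t * s)^-1) (s * (1 - t * s) ^- 2).
Proof.
move=> h.
have d2 : is_derive t 1 (fun t : R => t * s) s.
  have d := @is_deriveM _ _ (id : R -> R) (cst s) t 1 1 0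
    (is_derive_id _ _) (is_derive_cst _ _ _).
  by apply: (is_derive_eq d); rewrite scaler0 add0r [_ *: _]mulr1.
have d1 : is_derive t 1 (fun t : R => 1 - t * s) (- s).
  have d := @is_deriveB _ _ _ (cst (1:R)) (fun t : R => t * s) t 1 0 s
    (is_derive_cst _ _ _) d2.
  by apply: (is_derive_eq d); rewrite sub0r.
have d := @is_deriveV _ (fun t : R => 1 - t * s) t (- s) 1 h d1.
by apply: (is_derive_eq d); rewrite scalerN scaleNr opprK [_ *: _]mulrC.
Qed.

Lemma disc_der (F : C -> C) : disc_pos F ->
  exists F' : C -> C, forall z, normc z < 1 -> cder F z (F' z).
Proof.
move=> [Fd _]; have /choice[F' HF] : forall z, exists d, normc z < 1 -> cder F z d.
  by move=> z; have [/Fd[d hd]|h] := pselect (normc z < 1); [exists d|exists 0].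
by exists F'.
Qed.

(* The factor is (1 + t s) / (1 - t s), for which Schwarz-Pick makes the product
   monotone in t. *)
Lemma harnack_aux (F : C -> C) (z : C) (s : R) : disc_pos F -> normc z < 1 ->
  (s = normc z \/ s = - normc z) ->
  forall w : R -> R, w = (fun t => Re (F (z * t%:C)) * (2 * (1 - t * s)^-1 - 1)) ->
  if s == normc z then w 0 <= w 1 else w 1 <= w 0.
Proof.
move=> Fp z1 hs w wE; have [F' F'd] := disc_der Fp; have [Fd Fre] := Fp.
have zn := normc_ge0 z.
have zt (t : R) : 0 <= t <= 1 -> normc (z * t%:C) = normc z * t.
  by move=> /andP[t0 _]; rewrite normcM normc_real ger0_norm.
have zt1 (t : R) : 0 <= t <= 1 -> normc (z * t%:C) < 1.
  move=> ht; rewrite zt//; case/andP: ht => t0 t1.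
  by apply: le_lt_trans z1; rewrite ler_piMr.
pose u (t : R) := Re (F (z * t%:C)).
pose u' (t : R) := Re (F' (z * t%:C) * z).
have ud (t : R) : 0 <= t <= 1 -> is_derive t 1 u (u' t).
  move=> ht; have := F'd _ (zt1 t ht); rewrite -[z * t%:C]add0r => /(@cder_line 1).
  rewrite mul1r /u' add0r; congr (is_derive _ _ _ _).
  by apply/funext => r; rewrite mul1r add0r.
have ts (t : R) : 0 <= t <= 1 -> 0 < 1 - t * s.
  move=> /andP[t0 t1]; have : t * normc z <= normc z by rewrite ler_piMl.
  have : 0 <= t * normc z by rewrite mulr_ge0.
  by case: hs => ->; rewrite ?mulrN; lra.
pose q (t : R) := (1 - t * s)^-1.
have wd (t : R) : 0 <= t <= 1 -> is_derive t 1 w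
    (q t ^+ 2 * (2 * s * u t + (1 - (t * s) ^+ 2) * u' t)).
  move=> ht; rewrite wE; have d1 := ud t ht; have d0 := ts t ht.
  have d2 := is_derive_inv (lt0r_neq0 d0).
  have d3 := @is_deriveZ _ _ _ _ 2 t 1 _ d2.
  have d4 := @is_deriveB _ _ _ _ (cst (1:R)) t 1 _ _ d3 (is_derive_cst _ _ _).
  have d5 := is_deriveM d1 d4.
  apply: (is_derive_eq d5).
  transitivity (u t * (2 * (s * (1 - t * s) ^- 2) - 0) + (2 * (1 - t * s)^-1 - 1) * u' t).
    by [].
  have n0 : 1 - t * s != 0 by rewrite gt_eqF.
  by rewrite subr0 /q; move: (u t) (u' t) => a b; field.
have ub (t : R) : 0 <= t <= 1 -> `|(1 - (t * s) ^+ 2) * u' t| <= normc z * (2 * u t).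
  move=> ht; have := schwarz_pick Fp (zt1 t ht) (F'd _ (zt1 t ht)).
  have s2 : s ^+ 2 = normc z ^+ 2 by case: hs => ->; rewrite ?sqrrN.
  rewrite zt// (exprMn _ t s) s2 -exprMn (mulrC t) => h.
  have h0 : 0 <= 1 - (normc z * t) ^+ 2.
    by rewrite subr_ge0 expr_le1 ?mulr_ge0//;
      [have := zt1 t ht; rewrite zt//; exact: ltW|case/andP: ht].
  rewrite normrM (ger0_norm h0).
  apply: le_trans (_ : (1 - (normc z * t) ^+ 2) * (normc (F' (z * t%:C)) * normc z) <= _).
    by rewrite ler_wpM2l// -normcM normc_Re.
  by rewrite mulrA mulrC ler_wpM2l// mulrC.
have u0 (t : R) : 0 <= t <= 1 -> 0 <= u t by move=> ht; apply: Fre; exact: zt1.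
case: eqP => [sE|sN].
  apply: nondecreasing01 wd _ => t ht; rewrite mulr_ge0 ?sqr_ge0//.
  by have := ub t ht; rewrite -sE ler_norml => /andP[h _]; lra.
have {sN} sE : s = - normc z by case: hs.
have := @nondecreasing01 (fun t => - w t) _ (fun t ht => is_deriveN (wd t ht)).
rewrite lerN2; apply => t ht; rewrite oppr_ge0 mulr_ge0_le0 ?sqr_ge0//.
have nz : normc z = - s by rewrite sE opprK.
by have := ub t ht; rewrite nz ler_norml => /andP[_ h]; lra.
Qed.

Lemma harnack (F : C -> C) (z : C) : disc_pos F -> normc z < 1 ->
  Re (F 0) * (1 - normc z) <= Re (F z) * (1 + normc z) /\
  Re (F z) * (1 - normc z) <= Re (F 0) * (1 + normc z).
Proof.
move=> Fp z1; have n0 := normc_ge0 z; split.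
  have := harnack_aux Fp z1 (or_introl erefl) erefl.
  rewrite eqxx mulr0 mulr1 !mul0r subr0 invr1 mul1r.
  rewrite (_ : 2 * 1 - 1 = 1 :> R); last by ring.
  rewrite (_ : 2 * (1 - normc z)^-1 - 1 = (1 + normc z) / (1 - normc z)); last by field; lra.
  by rewrite mulr1 mulrA ler_pdivlMr//; lra.
(* If |z| = 0, the two choices of s coincide and the test in [harnack_aux] takes the other
   branch. *)
have [n00|nn0] := eqVneq (normc z) 0.
  by rewrite n00; have /eqP := n00; rewrite normc_eq0 => /eqP ->; rewrite subr0 addr0.
have := harnack_aux Fp z1 (or_intror erefl) erefl; rewrite ifF; last by apply/eqP; lra.
rewrite mulr0 mulr1 !mul0r subr0 invr1 mul1r opprK.
rewrite (_ : 2 * 1 - 1 = 1 :> R); last by ring.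
rewrite (_ : 2 * (1 + normc z)^-1 - 1 = (1 - normc z) / (1 + normc z)); last by field; lra.
by rewrite mulr1 mulrA ler_pdivrMr//; lra.
Qed.

(** Schwarz-Pick at z followed by Harnack's upper bound for Re F(z); a factor 1 + |z| cancels. *)
Lemma deriv_growth (F : C -> C) (z d : C) : disc_pos F -> normc z < 1 -> cder F z d ->
  normc d * (1 - normc z) ^+ 2 <= 2 * Re (F 0).
Proof.
move=> Fp z1 hd; have n0 := normc_ge0 z.
have h1 := schwarz_pick Fp z1 hd; have [_ h2] := harnack Fp z1.
have p : 0 < 1 + normc z by lra.
rewrite -(ler_pM2r p); apply: le_trans (_ : 2 * (Re (F z) * (1 - normc z)) <= _); last by lra.
apply: le_trans (_ : normc d * (1 - normc z ^+ 2) * (1 - normc z) <= _).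
  by rewrite le_eqVlt; apply/orP; left; apply/eqP; ring.
by rewrite mulrA ler_wpM2r//; lra.
Qed.

(** Integration of [deriv_growth] along the radius: 2 x |z| / (1 - t|z|)^2 is the derivative of 2 x
    / (1 - t|z|), so that primitive minus the rotated real part of F is nondecreasing in t. *)
Lemma value_growth (F : C -> C) (z : C) : disc_pos F -> normc z < 1 ->
  normc (F z - F 0) * (1 - normc z) <= 2 * Re (F 0) * normc z.
Proof.
move=> Fp z1; have n0 := normc_ge0 z; have [F' F'd] := disc_der Fp.
have [c c1 cE] := unit_dir (F z - F 0); set x := Re (F 0).
have zt (t : R) : 0 <= t <= 1 -> normc (z * t%:C) = normc z * t.
  by move=> /andP[t0 _]; rewrite normcM normc_real ger0_norm.
have zt1 (t : R) : 0 <= t <= 1 -> normc (z * t%:C) < 1.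
  move=> ht; rewrite zt//; case/andP: ht => t0 t1.
  by apply: le_lt_trans z1; rewrite ler_piMr.
have ts (t : R) : 0 <= t <= 1 -> 0 < 1 - t * normc z.
  move=> /andP[t0 t1]; have : t * normc z <= normc z by rewrite ler_piMl.
  by lra.
have := @nondecreasing01 (fun t => 2 * x * (1 - t * normc z)^-1 - Re (c * F (0 + z * t%:C)))
  (fun t => 2 * x * (normc z * (1 - t * normc z) ^- 2) - Re (c * (F' (z * t%:C) * z))) _ _.
case/(_ _ _)/Wrap.
- move=> t ht; have d1 := F'd _ (zt1 t ht).
  have d2 := is_derive_inv (lt0r_neq0 (ts t ht)).
  have d3 := @is_deriveZ _ _ _ _ (2 * x) t 1 _ d2.
  have h := @cder_line c 0 z (F' (z * t%:C)) F t; rewrite add0r in h.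
  exact: (is_deriveB d3 (h d1)).
- move=> t ht; have h := deriv_growth Fp (zt1 t ht) (F'd _ (zt1 t ht)).
  have p := ts t ht; rewrite subr_ge0.
  apply: le_trans (ler_norm _) _; apply: le_trans (normc_Re _) _.
  rewrite !normcM c1 mul1r.
  have -> : 2 * x * (normc z * (1 - t * normc z) ^- 2) =
    2 * x / (1 - t * normc z) ^+ 2 * normc z by ring.
  rewrite ler_wpM2r// ler_pdivlMr ?exprn_gt0//.
  by move: h; rewrite zt// [normc z * t]mulrC.
rewrite mulr0 addr0 mul0r subr0 invr1 mulr1 mulr1 add0r mul1r => h.
have E : Re (c * F z) - Re (c * F 0) = normc (F z - F 0).
  by rewrite -[RHS]/(Re (normc (F z - F 0))%:C) -cE mulrBr; case: (c * _) => ? ?; case: (c * _).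
rewrite -E.
have p : 0 < 1 - normc z by lra.
have : 2 * x * (1 - normc z)^-1 * (1 - normc z) = 2 * x by rewrite divfK// gt_eqF.
have : (Re (c * F z) - Re (c * F 0)) * (1 - normc z) <=
  (2 * x * (1 - normc z)^-1 - 2 * x) * (1 - normc z).
  by rewrite ler_wpM2r//; lra.
lra.
Qed.

End Growth.

(** * The derivative of the resolvent *)

Section Resolvent.
Variable R : realType.
Local Notation C := R[i].
Local Notation Re := complex.Re.
Local Notation Im := complex.Im.

Lemma cder_unique (f : C -> C) (z a b : C) : cder f z a -> cder f z b -> a = b.
Proof.
move=> fa fb; apply/eqP; rewrite -subr_eq0 -normc_eq0; apply/eqP.
apply/eqP; rewrite eq_le normc_ge0 andbT; apply/ler_addgt0Pr => e e0; rewrite add0r.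
have e2 : 0 < e / 2 by rewrite divr_gt0.
have [r r0 hr] := fa _ e2; have [s s0 hs] := fb _ e2.
pose t := Num.min r s / 2.
have m0 : 0 < Num.min r s by rewrite lt_min r0.
have t0 : 0 < t by rewrite divr_gt0.
have [tr ts] : t < r /\ t < s.
  have : Num.min r s <= r by rewrite ge_min lexx.
  have : Num.min r s <= s by rewrite ge_min lexx orbT.
  by move: m0; rewrite /t; move: (Num.min r s) => m; split; lra.
have nt : normc (z + t%:C - z) = t by rewrite addrC addKr normc_real ger0_norm// ltW.
have := hr (z + t%:C); have := hs (z + t%:C); rewrite nt => /(_ ts) h1 /(_ tr) h2.
have : normc ((a - b) * (z + t%:C - z)) <= e * t.
  rewrite (_ : (a - b) * _ = (f (z + t%:C) - f z - b * (z + t%:C - z))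
     - (f (z + t%:C) - f z - a * (z + t%:C - z))); last by ring.
  by apply: le_trans (le_normcD _ _) _; rewrite normcN; lra.
by rewrite normcM nt ler_pM2r.
Qed.

(** The mean value inequality on the segment from b to a, which stays in the disc by convexity, for
    the real part of f rotated by [unit_dir]. *)
Lemma lipschitz_disc (f : C -> C) (K : R) :
  (forall z, normc z < 1 -> exists2 d, cder f z d & normc d <= K) ->
  forall a b, normc a < 1 -> normc b < 1 -> normc (f a - f b) <= K * normc (a - b).
Proof.
move=> fd a b a1 b1; have [c c1 cE] := unit_dir (f a - f b).
have /choice[f' Hf] : forall z, exists d, normc z < 1 -> cder f z d /\ normc d <= K.
  move=> z; have [/fd[d hd hK]|h] := pselect (normc z < 1); first by exists d.
  by exists 0.
pose v := a - b.
have in1 (t : R) : 0 <= t <= 1 -> normc (b + v * t%:C) < 1.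
  move=> /andP[t0 t1].
  have -> : b + v * t%:C = a * t%:C + b * (1 - t)%:C by rewrite rmorphB rmorph1 /v; ring.
  apply: le_lt_trans (le_normcD _ _) _; rewrite !normcM !normc_real !ger0_norm//; last by lra.
  have [->|tn0] := eqVneq t 0; first by rewrite mulr0 subr0 mulr1 add0r.
  have tp : 0 < t by rewrite lt_def tn0.
  have : normc a * t < 1 * t by rewrite ltr_pM2r.
  have : normc b * (1 - t) <= 1 * (1 - t) by apply: ler_wpM2r; [lra|exact: ltW].
  by lra.
have lin (t : R) : is_derive t 1 (fun t : R => t * (K * normc v)) (K * normc v).
  have d := @is_deriveM _ _ (id : R -> R) (cst (K * normc v)) t 1 1 0
    (is_derive_id _ _) (is_derive_cst _ _ _).
  by apply: (is_derive_eq d); rewrite scaler0 add0r [_ *: _]mulr1.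
have der (t : R) : 0 <= t <= 1 -> is_derive t 1
    (fun t : R => t * (K * normc v) - Re (c * f (b + v * t%:C)))
    (K * normc v - Re (c * (f' (b + v * t%:C) * v))).
  move=> ht; have [d1 _] := Hf _ (in1 t ht).
  exact: (is_deriveB (lin t) (cder_line c d1)).
have pos (t : R) : 0 <= t <= 1 -> 0 <= K * normc v - Re (c * (f' (b + v * t%:C) * v)).
  move=> ht; have [_ d1] := Hf _ (in1 t ht); rewrite subr_ge0.
  apply: le_trans (ler_norm _) _; apply: le_trans (normc_Re _) _.
  by rewrite !normcM c1 mul1r ler_wpM2r// normc_ge0.
have := nondecreasing01 der pos.
rewrite mulr0 addr0 mulr1 mul0r mul1r (_ : b + v = a); last by rewrite /v addrC subrK.
move=> h.
have E : Re (c * f a) - Re (c * f b) = normc (f a - f b).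
  by rewrite -[RHS]/(Re (normc (f a - f b))%:C) -cE mulrBr; case: (c * _) => ? ?; case: (c * _).
rewrite -E; lra.
Qed.

(** The cubic is the denominator of [A] minus its numerator, so its roots solve A = 1. It is
    positive from 8 on, so a value <= 0 beyond r_0 would produce a root beyond r_0, against its
    maximality. *)
Lemma cubic_gt0 (x : R) : r0 R < x -> 0 < x ^+ 3 - 3 * x ^+ 2 - 18 * x + 4.
Proof.
move=> xr; rewrite ltNge; apply/negP => px.
have x8 : x <= 8.
  rewrite leNgt; apply/negP => x8.
  have : 0 < (x - 8) * (x - 8) * (x - 8) by rewrite !mulr_gt0//; lra.
  have : 0 < (x - 8) * (x - 8) by rewrite !mulr_gt0//; lra.
  by lra.
pose p : {poly R} := 'X ^+ 3 - 3%:P * 'X ^+ 2 - 18%:P * 'X + 4%:P.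
have pE y : p.[y] = y ^+ 3 - 3 * y ^+ 2 - 18 * y + 4 by rewrite /p !hornerE.
have [|y /andP[xy _] /rootP] := @poly_ivt _ p _ _ x8.
  by rewrite !pE; apply/andP; split; lra.
rewrite pE => y0.
have [_ /(_ y)] := r0_largest_root R.
have -> : A y = 1.
  rewrite /A (_ : _ - _ = 6 * y * (1 + y)); last by lra.
  rewrite divff// !mulf_neq0//; apply/eqP => h; first by move: y0; rewrite h; lra.
  have yE : y = -1 by lra.
  by move: y0; rewrite yE; lra.
by move=> /(_ erefl); lra.
Qed.

(** The cubic is negative at 28/5. This number is chosen slightly above the largest root of x^3 - 7
    x^2 + 10 x - 12, whose sign decides the last inequality of [A_bounds]. *)
Lemma gt_r0 (x : R) : r0 R < x -> 28 / 5 < x.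
Proof.
move=> xr; apply: le_lt_trans xr; rewrite leNgt; apply/negP => /cubic_gt0.
by lra.
Qed.

(** The left side of the last inequality is the sum of the growth bounds for P(z) - P(0) and z P'(z)
    at t = |z| = 1/(x - 1), where t/(1 - t) = 1/(x - 2) and t/(1 - t)^2 = (x - 1)/(x - 2)^2. *)
Lemma A_bounds (x : R) : r0 R < x ->
  [/\ 0 < A x, A x < 1 & 2 * x * ((x - 2)^-1 + (x - 1) * (x - 2)^-1 ^+ 2) <= A x * (1 + x)].
Proof.
move=> xr; have x5 := gt_r0 xr; have p := cubic_gt0 xr.
have xx : 0 < x * (x - 28 / 5) by rewrite mulr_gt0//; lra.
have n0 : 0 < 6 * x * (1 + x) by rewrite !mulr_gt0//; lra.
set D := (1 + x) ^+ 3 - 3 * (5 * x - 1).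
have DE : D = (x - 2) * (x ^+ 2 + 5 * x - 2) by rewrite /D; ring.
have D0 : 0 < D by rewrite /D; lra.
have x2 : 0 < x - 2 by lra.
have y0 : 0 < x ^+ 2 + 5 * x - 2 by lra.
rewrite /A -/D; split; first by rewrite divr_gt0.
  by rewrite ltr_pdivrMr// /D; lra.
have -> : 2 * x * ((x - 2)^-1 + (x - 1) * (x - 2)^-1 ^+ 2) = 2 * x * (2 * x - 3) / (x - 2) ^+ 2.
  by field; rewrite gt_eqF.
rewrite [leRHS]mulrAC ler_pdivrMr ?exprn_gt0// [leRHS]mulrAC ler_pdivlMr// DE.
have : 0 <= 2 * x * (x - 2) * (x ^+ 3 - 7 * x ^+ 2 + 10 * x - 12).
  rewrite !mulr_ge0//; [lra|lra|].
  have : 0 < x * (x - 28 / 5) * (x - 28 / 5) by rewrite mulr_gt0//; lra.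
  by lra.
by lra.
Qed.

(** The squares differ by (1 - k^2)(k^2 - |u|^2). After division by (1 - k^2)|1 + u| this says that
    1/(1 + u) lies in the disc of centre 1/(1 - k^2) and radius k/(1 - k^2). *)
Lemma inverse_in_disc (u : C) (k : R) : 0 <= k -> k < 1 -> normc u <= k ->
  normc ((k ^+ 2)%:C + u) <= k * normc (1 + u).
Proof.
move=> k0 k1 uk.
rewrite -(@ler_pXn2r _ 2) ?nnegrE ?mulr_ge0 ?normc_ge0// exprMn !normc_sqr.
have : normc u ^+ 2 <= k ^+ 2 by rewrite ler_pXn2r ?nnegrE ?normc_ge0.
rewrite normc_sqr; case: (u) => a b /= h.
have : 0 <= (1 - k ^+ 2) * (k ^+ 2 - (a ^+ 2 + b ^+ 2)).
  by rewrite mulr_ge0//; [rewrite subr_ge0 expr_le1// ltW|lra].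
by lra.
Qed.

(* The image of the disc |u - m| <= k |m| under inversion has centre
   1 / ((1 - k^2) m). *)
Lemma resolvent_derivative (P G : C -> C) (k : R) : disc_pos P ->
  r0 R < Re (P 0) -> k = A (Re (P 0)) ->
  (forall w, normc w < 1 -> exists d, cder G w d) ->
  (forall w, normc w < 1 -> normc (G w) < 1) ->
  (forall w, normc w < 1 -> G w * (1 + P (G w)) = w) ->
  exists2 c : C, c != 0 & forall w, normc w < 1 ->
    exists2 d, cder G w d & normc (d - c) <= k * normc c.
Proof.
move=> Pp xr kE Gd G1 GE; set x := Re (P 0); have [k0 k1 kx] := A_bounds xr.
rewrite -kE -/x in k0 k1 kx; have x5 := gt_r0 xr; rewrite -/x in x5.
have mx : 1 + x <= normc (1 + P 0).
  by apply: le_trans (normc_Re _); apply: le_trans (ler_norm _); rewrite /x; case: (P 0).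
have m0 : 1 + P 0 != 0 by rewrite -normc_gt0; lra.
have k2 : 0 < 1 - k ^+ 2 by rewrite subr_gt0 expr_lt1// ltW.
have k20 : (1 - k ^+ 2)%:C != 0 by rewrite -normc_gt0 normc_real normr_gt0 gt_eqF.
exists (((1 - k ^+ 2)%:C * (1 + P 0))^-1); first by rewrite invr_eq0 mulf_neq0.
move=> w w1; have [d hd] := Gd w w1; exists d => //.
have [P' P'd] := disc_der Pp.
set z := G w; have z1 : normc z < 1 by exact: G1.
have zn := normc_ge0 z.
have N1 : d * (1 + (P z + z * P' z)) = 1.
  have h1 := cderM hd (cderD (cder_cst 1 w) (cder_comp hd (P'd _ z1))).
  have r : 0 < 1 - normc w by lra.
  have h2 : cder id w (d * (1 + P z) + z * (0 + P' z * d)).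
    apply: (cder_near r _ h1) => y hy; apply: GE.
    by have := le_normcD (y - w) w; rewrite subrK; lra.
  by rewrite -[RHS](cder_unique h2 (cder_id w)); ring.
(* With t = |z|, Harnack's lower bound for Re P(z) turns t (1 + Re P(z)) < 1 into a bound that is
   violated when (1 - t)(t (x - 1) - 1) > 0. *)
have tx : normc z * (x - 1) <= 1.
  have [h _] := harnack Pp z1.
  have h2 : normc z * (1 + Re (P z)) < 1.
    apply: (le_lt_trans _ w1); rewrite -[in leRHS](GE w w1) normcM ler_wpM2l//.
    by apply: le_trans (normc_Re _); apply: le_trans (ler_norm _); case: (P _).
  rewrite leNgt; apply/negP => h3.
  have h4 : normc z * (1 + Re (P z)) * (1 + normc z) < 1 * (1 + normc z).
    by rewrite ltr_pM2r//; lra.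
  have h5 : normc z * (x * (1 - normc z)) <= normc z * (Re (P z) * (1 + normc z)).
    by rewrite ler_wpM2l.
  have h6 : 0 < (1 - normc z) * (normc z * (x - 1) - 1) by rewrite mulr_gt0//; lra.
  lra.
have NQ : normc (P z + z * P' z - P 0) <= k * normc (1 + P 0).
  apply: le_trans (_ : k * (1 + x) <= _); last by rewrite ler_wpM2l// ltW.
  apply: le_trans kx.
  have ha := value_growth Pp z1; have hb := deriv_growth Pp z1 (P'd _ z1).
  rewrite -/x in ha hb.
  rewrite (_ : _ - P 0 = (P z - P 0) + z * P' z); last by ring.
  apply: le_trans (le_normcD _ _) _; rewrite normcM mulrDr.
  move: ha hb tx z1 zn; move: (normc (P z - P 0)) (normc (P' z)) (normc z) => a b t ha hb tx z1 zn.
  have x2 : 0 < x - 2 by lra.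
  set y := (x - 2)^-1; have y0 : 0 < y by rewrite invr_gt0.
  have yx : y * (x - 2) = 1 by rewrite mulVf// gt_eqF.
  have t1 : 0 < 1 - t by lra.
  (* This and the next inequality are two forms of t <= 1/(x - 1); they replace the powers of 1/(1 -
     t) in the growth bounds by powers of y = 1/(x - 2). *)
  have ty : t <= y * (1 - t).
    have hy : 0 <= y * (1 - t - t * (x - 2)) by apply: mulr_ge0; [exact: ltW|lra].
    have e : y * (t * (x - 2)) = t by rewrite mulrCA yx mulr1.
    by lra.
  have oy : 1 <= (x - 1) * y * (1 - t).
    have hy : 0 <= y * (1 - t * (x - 1)) by apply: mulr_ge0; [exact: ltW|lra].
    by lra.
  have x0 : 0 <= 2 * x by lra.
  apply: lerD.
    rewrite -(ler_pM2r t1); apply: le_trans ha _; rewrite -[leRHS]mulrA ler_wpM2l//.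
  rewrite -(ler_pM2r (exprn_gt0 2 t1)) -[leLHS]mulrA.
  apply: le_trans (_ : t * (2 * x) <= _); first by rewrite ler_wpM2l.
  have : t <= (x - 1) * y ^+ 2 * (1 - t) ^+ 2.
    apply: le_trans ty _; rewrite -[leLHS]mulr1.
    rewrite [leRHS](_ : _ = (y * (1 - t)) * ((x - 1) * y * (1 - t))); last by ring.
    by rewrite ler_wpM2l// mulr_ge0// ltW.
  by move=> /(ler_wpM2l x0); lra.
set N := P z + z * P' z; set m := 1 + P 0; rewrite -/N -/m in N1 NQ m0 mx.
pose u := (N - P 0) / m.
have um : (1 + u) * m = 1 + N by rewrite mulrDl mul1r /u divfK// /m; ring.
have uk : normc u <= k.
  by rewrite /u normcM normcV ler_pdivrMr// normc_gt0.
have dn0 : d * ((1 + u) * m) = 1 by rewrite um.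
have u10 : 1 + u != 0.
  by apply/eqP => h; move: dn0; rewrite h mul0r mulr0 => /eqP; rewrite eq_sym oner_eq0.
have dE : d = ((1 + u) * m)^-1.
  by apply: (mulIf (mulf_neq0 u10 m0)); rewrite dn0 mulVf// mulf_neq0.
have -> : d - ((1 - k ^+ 2)%:C * m)^-1 =
    - (((k ^+ 2)%:C + u) / (1 + u)) * ((1 - k ^+ 2)%:C * m)^-1.
  have K2 : (1 - k ^+ 2)%:C = 1 - (k ^+ 2)%:C by rewrite rmorphB rmorph1.
  rewrite K2 in k20 *; rewrite dE; move: ((k ^+ 2)%:C) k20 => a a0; field.
  by rewrite a0 m0 u10.
rewrite normcM ler_wpM2r ?normc_ge0// normcN normcM normcV ler_pdivrMr ?normc_gt0//.
exact: (inverse_in_disc (ltW k0) k1 uk).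
Qed.
End Resolvent.

(** * Extension by reflection in the circle *)

Section Extension.
Variable R : realType.
Local Notation C := R[i].
Local Notation Re := complex.Re.
Local Notation Im := complex.Im.

Lemma cauchy_real (u : R^nat) :
  (forall e, 0 < e -> exists N, forall n, (N <= n)%N -> `|u n - u N| <= e) ->
  exists l : R, u n @[n --> \oo] --> l.
Proof.
move=> Hu; apply/cvg_ex; apply/cauchy_cvgP/cauchy_exP => e e0.
have e2 : 0 < e / 2 by rewrite divr_gt0.
have [N HN] := Hu _ e2; exists (u N); exists N => // n /= Nn.
by rewrite /ball/= distrC; apply: le_lt_trans (HN n Nn) _; rewrite ltr_pdivrMr//; lra.
Qed.

Lemma cauchy_complex (u : nat -> C) :
  (forall e, 0 < e -> exists N, forall n, (N <= n)%N -> normc (u n - u N) <= e) ->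
  exists l, forall e, 0 < e -> exists N, forall n, (N <= n)%N -> normc (u n - l) <= e.
Proof.
move=> Hu.
have [a ca] : exists a : R, Re (u n) @[n --> \oo] --> a.
  apply: cauchy_real => e /Hu[N HN]; exists N => n /HN; apply: le_trans.
  by apply: le_trans (normc_Re _); case: (u n) => ? ?; case: (u N).
have [b cb] : exists b : R, Im (u n) @[n --> \oo] --> b.
  apply: cauchy_real => e /Hu[N HN]; exists N => n /HN; apply: le_trans.
  by apply: le_trans (normc_Im _); case: (u n) => ? ?; case: (u N).
exists (a +i* b) => e e0; have e2 : 0 < e / 2 by rewrite divr_gt0.
have /cvgrPdist_le/(_ _ e2)[N _ HN] := ca; have /cvgrPdist_le/(_ _ e2)[M _ HM] := cb.
exists (maxn N M) => n; rewrite geq_max => /andP[/HN h1 /HM h2].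
apply: le_trans (normc_ReIm _) _; move: h1 h2; rewrite /= distrC [X in _ -> X <= _ -> _]distrC.
by case: (u n) => ? ? /=; lra.
Qed.

Definition reflect_disc (z : C) : C := if normc z <= 1 then z else (conjc z)^-1.

Lemma reflect_disc_le1 z : normc (reflect_disc z) <= 1.
Proof.
rewrite /reflect_disc; case: ifPn => //; rewrite -ltNge => h.
by rewrite normcV normc_conj invf_le1 ?ltW//; lra.
Qed.

Lemma conjcB (a b : C) : conjc (a - b) = conjc a - conjc b.
Proof. exact: rmorphB. Qed.

(** Outside the disc the distance is divided by |a||b| >= 1. In the mixed case the image of b is M b
    with M = 1/|b|^2, and |a - b|^2 - |a - M b|^2 = (1 - M)(|b|^2 + 1 - 2 Re(a conj(b))), which is
    at least (1 - M)(|b| - 1)^2. *)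
Lemma reflect_disc_lip a b : normc (reflect_disc a - reflect_disc b) <= normc (a - b).
Proof.
wlog ab : a b / normc a <= normc b.
  move=> H; have [/H//|/ltW/H] := leP (normc a) (normc b).
  by rewrite normcB [leRHS]normcB.
rewrite /reflect_disc; case: ifPn => a1; case: ifPn => b1 //.
- rewrite -ltNge in b1; have b0 : b != 0 by rewrite -normc_gt0; lra.
  have -> : (conjc b)^-1 = (normc b ^+ 2)^-1%:C * b.
    apply: (@mulfI _ (conjc b)); first by rewrite conjc_eq0.
    rewrite mulfV ?conjc_eq0// mulrCA [conjc b * b]mulrC.
    have -> : b * conjc b = (normc b ^+ 2)%:C.
      by rewrite normc_sqr; case: (b) => x y; simpc; rewrite -!expr2 [y * x]mulrC addNr.
    by rewrite -rmorphM mulVf ?rmorph1// sqrf_eq0 normc_eq0.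
  set M := (normc b ^+ 2)^-1.
  rewrite -(@ler_pXn2r _ 2) ?nnegrE ?normc_ge0// !normc_sqr.
  have nb := normc_sqr b; have na := normc_sqr a.
  have nb1 : 1 < normc b ^+ 2 by rewrite expr_gt1//; lra.
  have M0 : 0 < M by rewrite invr_gt0; lra.
  have M1 : M * normc b ^+ 2 = 1 by rewrite mulVf// gt_eqF//; lra.
  have Ml : M < 1 by rewrite invf_lt1//; lra.
  have dot : Re (a * conjc b) <= normc b.
    apply: le_trans (le_trans (ler_norm _) (normc_Re _)) _.
    by rewrite normcM normc_conj ler_piMl// normc_ge0.
  have sq : 0 <= (normc b - 1) ^+ 2 by exact: sqr_ge0.
  have pos : 0 <= (1 - M) * (normc b ^+ 2 + 1 - 2 * Re (a * conjc b)).
    by rewrite mulr_ge0//; lra.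
  move: pos M1; clearbody M; rewrite nb; clear; case: a => a1 a2; case: b => b1 b2 /= pos M1.
  have M2 : M * (M * (b1 ^+ 2 + b2 ^+ 2)) = M by rewrite M1 mulr1.
  by lra.
- by move: a1; rewrite (le_trans ab).
rewrite -!ltNge in a1 b1.
have a0 : conjc a != 0 by rewrite conjc_eq0 -normc_gt0; lra.
have b0 : conjc b != 0 by rewrite conjc_eq0 -normc_gt0; lra.
have -> : (conjc a)^-1 - (conjc b)^-1 = conjc (b - a) * ((conjc a)^-1 * (conjc b)^-1).
  by rewrite conjcB; field; rewrite a0 b0.
rewrite !normcM !normcV !normc_conj normcB ler_piMr ?normc_ge0//.
by rewrite mulr_ile1 ?invr_ge0 ?normc_ge0// invf_le1 ?ltW//; lra.
Qed.

(** As g is controlled only in the open disc, phi(z) is the limit of g at s_n times the reflected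
    point, with s_n increasing to 1. The sequence is Cauchy by the Lipschitz bound, and one formula
    covers the disc, the circle and the exterior. *)
Lemma lipschitz_reflection (g : C -> C) (K : R) : 0 <= K ->
  (forall a b, normc a < 1 -> normc b < 1 -> normc (g a - g b) <= K * normc (a - b)) ->
  exists phi : C -> C,
  [/\ forall a b, normc (phi a - phi b) <= K * normc (a - b),
      forall z, normc z < 1 -> phi z = g z &
      forall z, 1 < normc z -> phi z = g (conjc z)^-1].
Proof.
move=> K0 gK; pose h n : R := n.+2%:R^-1.
have h0 n : 0 < h n by rewrite invr_gt0.
have h1 n : h n < 1 by rewrite invf_lt1// ltr1n.
pose s n : C := (1 - h n)%:C.
have ns n z : normc (s n * reflect_disc z) < 1.
  rewrite normcM normc_real ger0_norm; last by have := h1 n; lra.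
  apply: (@le_lt_trans _ _ (1 - h n)); last by have := h0 n; lra.
  by rewrite ler_piMr ?reflect_disc_le1//; have := h1 n; lra.
have hsmall (e : R) : 0 < e -> exists N, forall n, (N <= n)%N -> h n <= e.
  move=> e0; exists (Num.bound e^-1) => n Nn.
  rewrite -[leRHS]invrK lef_pV2 ?posrE ?invr_gt0//.
  have : e^-1 < (Num.bound e^-1)%:R by rewrite archi_boundP// invr_ge0 ltW.
  have : (Num.bound e^-1)%:R <= n%:R :> R by rewrite ler_nat.
  have : n%:R <= n.+2%:R :> R by rewrite ler_nat (leqW (leqnSn n)).
  lra.
have dist n w : normc w <= 1 -> normc (s n * w - w) <= h n.
  move=> w1; rewrite (_ : s n * w - w = (- h n)%:C * w); last first.
    by rewrite /s rmorphB rmorph1 rmorphN; ring.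
  by rewrite normcM normc_real normrN ger0_norm ?(ltW (h0 _))// ler_piMr// ltW.
have K1 : 0 < 2 * K + 1 by lra.
have /choice[phi Hphi] : forall z, exists l, forall e, 0 < e -> exists N, forall n, (N <= n)%N ->
    normc (g (s n * reflect_disc z) - l) <= e.
  move=> z; apply: cauchy_complex => e e0.
  have [N HN] := hsmall _ (divr_gt0 e0 K1); exists N => n Nn /=.
  apply: (le_trans (gK _ _ (ns n z) (ns N z))).
  have r1 := reflect_disc_le1 z.
  have d1 := dist n _ r1; have d2 := dist N _ r1.
  have := ler_normcB (s n * reflect_disc z) (reflect_disc z) (s N * reflect_disc z).
  rewrite [normc (reflect_disc z - _)]normcB => d3.
  have hn := HN n Nn; have hN := HN N (leqnn N).
  apply: le_trans (_ : K * (2 * (e / (2 * K + 1))) <= _).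
    by rewrite ler_wpM2l//; lra.
  rewrite mulrA mulrA ler_pdivrMr//.
  have := mulr_ge0 K0 (ltW e0); lra.
exists phi.
have lip a b : normc (phi a - phi b) <= K * normc (a - b).
  apply/ler_addgt0Pr => e e0; have e2 : 0 < e / 2 by rewrite divr_gt0.
  have [N HN] := Hphi a _ e2; have [M HM] := Hphi b _ e2.
  have := HN _ (leq_maxl N M); have := HM _ (leq_maxr N M); set n := maxn N M => t1 t2.
  have t3 : normc (g (s n * reflect_disc a) - g (s n * reflect_disc b)) <= K * normc (a - b).
    apply: (le_trans (gK _ _ (ns n a) (ns n b))); rewrite ler_wpM2l// -mulrBr normcM.
    apply: le_trans (reflect_disc_lip a b); rewrite ler_piMl ?normc_ge0//.
    by rewrite normc_real ger0_norm; have := h0 n; have := h1 n; lra.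
  have := ler_normcB (phi a) (g (s n * reflect_disc a)) (phi b).
  have := ler_normcB (g (s n * reflect_disc a)) (g (s n * reflect_disc b)) (phi b).
  rewrite [normc (phi a - g _)]normcB; lra.
have val z w : reflect_disc z = w -> normc w < 1 -> phi z = g w.
  move=> zw w1; apply/eqP; rewrite -subr_eq0 -normc_eq0 eq_le normc_ge0 andbT.
  apply/ler_addgt0Pr => e e0; rewrite add0r; have e2 : 0 < e / 2 by rewrite divr_gt0.
  have [N HN] := Hphi z _ e2; have K2 : 0 < 2 * (K + 1) by lra.
  have [M HM] := hsmall _ (divr_gt0 e0 K2).
  have := HN _ (leq_maxl N M); have := HM _ (leq_maxr N M); set n := maxn N M => t1 t2.
  have t3 : normc (g (s n * reflect_disc z) - g w) <= e / 2.
    have nsz := ns n z; rewrite zw in nsz *.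
    apply: (le_trans (gK _ _ nsz w1)).
    have d := dist n w (ltW w1).
    apply: le_trans (_ : (K + 1) * (e / (2 * (K + 1))) <= _).
      by rewrite ler_pM ?normc_ge0//; lra.
    by rewrite le_eqVlt; apply/orP; left; apply/eqP; field; lra.
  have := ler_normcB (phi z) (g (s n * reflect_disc z)) (g w).
  by rewrite [normc (phi z - g (s n * _))]normcB; lra.
split=> // z z1.
  by apply: val => //; rewrite /reflect_disc ltW.
apply: val; first by rewrite /reflect_disc leNgt z1.
by rewrite normcV normc_conj invf_lt1//; lra.
Qed.

End Extension.

(** * Small Lipschitz perturbations of a linear map *)

Section Homeo.
Variable R : realType.
Local Notation C := R[i].
Local Notation Re := complex.Re.
Local Notation Im := complex.Im.

Lemma lipschitz_continuous_complex (f : C -> C) (M : R) :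
  (forall a b, normc (f a - f b) <= M * normc (a - b)) ->
  continuous (f : Cplane R -> Cplane R).
Proof.
move=> fM z U /nbhs_ballP[e /= e0 eU]; apply/nbhs_ballP.
have eE : e = (Re e)%:C by rewrite RRe_real// gtr0_real.
have e0' : 0 < Re e by rewrite -ltcR -eE.
have M1 : 0 < `|M| + 1 by have := normr_ge0 M; lra.
have d0 : 0 < (Re e / (`|M| + 1))%:C by rewrite ltcR divr_gt0.
exists (Re e / (`|M| + 1))%:C => //= w; rewrite /ball_ /= => h.
have {}h : normc (z - w) < Re e / (`|M| + 1) by rewrite -ltcR.
apply: eU; rewrite /ball/= /ball_/= eE norm_normc ltcR.
apply: le_lt_trans (fM _ _) _.
apply: le_lt_trans (_ : (`|M| + 1) * normc (z - w) < _).
  by rewrite ler_wpM2r ?normc_ge0//; have := ler_norm M; lra.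
by move: h; rewrite ltr_pdivlMr// mulrC.
Qed.

(** The lower Lipschitz constant |c| - K gives injectivity and a Lipschitz inverse. Solving h(z) = y
    is finding a fixed point of z -> (y - phi(z))/c, a contraction of ratio K/|c|. *)
Lemma perturbation_homeomorphism (c : C) (phi : C -> C) (K : R) : 0 <= K -> K < normc c ->
  (forall a b, normc (phi a - phi b) <= K * normc (a - b)) ->
  homeomorphism (fun z : Cplane R => c * z + phi z : Cplane R).
Proof.
move=> K0 Kc phiK; have c0 : c != 0 by rewrite -normc_gt0; lra.
pose h z := c * z + phi z.
have hl a b : (normc c - K) * normc (a - b) <= normc (h a - h b).
  have := lerB_normc (c * (a - b)) (phi b - phi a).
  rewrite normcM (_ : c * (a - b) - (phi b - phi a) = h a - h b); last by rewrite /h; ring.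
  by have := phiK b a; rewrite [normc (b - a)]normcB; lra.
have hu a b : normc (h a - h b) <= (normc c + K) * normc (a - b).
  have := le_normcD (c * (a - b)) (phi a - phi b).
  rewrite normcM (_ : c * (a - b) + (phi a - phi b) = h a - h b); last by rewrite /h; ring.
  by have := phiK a b; lra.
have nc : 0 < normc c by lra.
pose q := K / normc c.
have q0 : 0 <= q by rewrite divr_ge0// ltW.
have q1 : q < 1 by rewrite ltr_pdivrMr// mul1r.
have surj y : exists z, h z = y.
  pose T z := (y - phi z) / c.
  have Tq a b : normc (T a - T b) <= q * normc (a - b).
    rewrite (_ : T a - T b = (phi b - phi a) / c); last by rewrite /T; field.
    rewrite normcM normcV ler_pdivrMr// mulrAC divfK ?gt_eqF//.
    by rewrite -(normcB a b) normcB in phiK * || by rewrite [normc (a - b)]normcB.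
  pose z n := iter n T 0; pose D := normc (T 0).
  have D0 : 0 <= D by exact: normc_ge0.
  have q1' : 0 < 1 - q by lra.
  have b0 k : normc (z k) <= D / (1 - q).
    rewrite ler_pdivlMr//; elim: k => [|k IH]; first by rewrite normc0 mul0r.
    have := ler_normcB (T (z k)) (T 0) 0; rewrite !subr0 => h1.
    have := Tq (z k) 0; rewrite subr0 => h2.
    have h3 : (1 - q) * normc (z k.+1) <= (1 - q) * (q * normc (z k) + D).
      by rewrite ler_wpM2l ?(ltW q1')//= -/(z k); rewrite /D; lra.
    have h4 : q * (normc (z k) * (1 - q)) <= q * D by rewrite ler_wpM2l.
    by lra.
  have bn n k : normc (z (n + k)%N - z n) <= q ^+ n * (D / (1 - q)).
    elim: n => [|n IH]; first by rewrite expr0 mul1r subr0 add0n.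
    rewrite addSn; apply: le_trans (Tq _ _) _.
    by rewrite exprS -mulrA ler_wpM2l.
  have qn (e : R) : 0 < e -> exists N, q ^+ N * (D / (1 - q)) <= e.
    move=> e0; have p : 0 < D / (1 - q) + 1 by have := divr_ge0 D0 (ltW q1'); lra.
    have /cvgrPdist_le/(_ _ (divr_gt0 e0 p))[N _ HN] :
      (fun n => q ^+ n) n @[n --> \oo] --> (0 : R) by apply: cvg_expr; rewrite ger0_norm.
    exists N; have := HN N (leqnn N); rewrite /= sub0r normrN ger0_norm ?exprn_ge0//.
    rewrite ler_pdivlMr//; apply: le_trans; rewrite ler_wpM2l ?exprn_ge0//; lra.
  have [l Hl] : exists l, forall e, 0 < e -> exists N, forall n, (N <= n)%N -> normc (z n - l) <= e.
    apply: cauchy_complex => e /qn[N HN]; exists N => n Nn.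
    by apply: le_trans HN; have := bn N (n - N)%N; rewrite subnKC.
  exists l; have Tl : T l = l.
    apply/eqP; rewrite -subr_eq0 -normc_eq0 eq_le normc_ge0 andbT.
    apply/ler_addgt0Pr => e e0; rewrite add0r; have e2 : 0 < e / 2 by rewrite divr_gt0.
    have [N HN] := Hl _ e2.
    have t1 := HN N (leqnn N); have t2 := HN N.+1 (leqnSn N).
    have t3 : normc (T l - z N.+1) <= normc (z N - l).
      apply: le_trans (Tq l (z N)) _; rewrite normcB ler_piMl ?normc_ge0//; exact: ltW.
    by have := ler_normcB (T l) (z N.+1) l; lra.
  by rewrite /h -{1}Tl /T mulrCA mulfV// mulr1 subrK.
have /choice[f fE] := surj.
have hinj a b : h a = h b -> a = b.
  move=> E; have := hl a b; rewrite E subrr normc0 pmulr_rle0; last by lra.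
  move=> h0; apply/eqP; rewrite -subr_eq0 -normc_eq0 eq_le h0 normc_ge0//.
split; first exact: (lipschitz_continuous_complex hu).
exists f; split.
- apply: (@lipschitz_continuous_complex f (normc c - K)^-1) => a b.
  have p : 0 < normc c - K by lra.
  by have := hl (f a) (f b); rewrite !fE mulrC -ler_pdivlMr// mulrC.
- by move=> a; apply: hinj; rewrite fE.
- by move=> a; rewrite -[RHS]fE.
Qed.
End Homeo.

(** * Directional derivatives, the Beltrami inequality and the extension *)

Section Directional.
Variable R : realType.
Local Notation C := R[i].
Local Notation Re := complex.Re.
Local Notation Im := complex.Im.
Local Notation plane := (R * R)%type.

(** Only real increments along v occur, because the extension involves conj(z) outside the disc and
    need not be complex differentiable there. *)
Definition ddir (f : C -> C) (z v a : C) := forall e : R, 0 < e ->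
  exists2 r : R, 0 < r & forall t : R, `|t| < r ->
    normc (f (z + t%:C * v) - f z - t%:C * a) <= e * `|t|.

Lemma cder_ddir f z d v : normc v = 1 -> cder f z d -> ddir f z v (d * v).
Proof.
move=> v1 fd e e0; have [r r0 hr] := fd _ e0; exists r => // t tr.
have nt : normc (z + t%:C * v - z) = `|t|.
  by rewrite addrC addKr normcM v1 mulr1 normc_real.
have := hr (z + t%:C * v); rewrite nt => /(_ tr).
by rewrite [z + _]addrC addrK mulrCA.
Qed.

Lemma cder_conj_ddir f z d v : normc v = 1 -> cder f (conjc z) d ->
  ddir (fun w => f (conjc w)) z v (d * conjc v).
Proof.
move=> v1 fd e e0; have v1' : normc (conjc v) = 1 by rewrite normc_conj.
have [r r0 hr] := cder_ddir v1' fd e0; exists r => // t tr.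
have E : conjc (z + t%:C * v) = conjc z + t%:C * conjc v.
  case: (z) => ? ?; case: (v) => ? ?; apply/eqP; rewrite eq_complex /=.
  by apply/andP; split; apply/eqP; ring.
by have := hr t tr; rewrite -E.
Qed.

Lemma ddirD f g z v a b : ddir f z v a -> ddir g z v b ->
  ddir (fun w => f w + g w) z v (a + b).
Proof.
move=> fd gd e e0; have e2 : 0 < e / 2 by rewrite divr_gt0.
have [r r0 hr] := fd _ e2; have [s s0 hs] := gd _ e2.
exists (Num.min r s) => [|t]; first by rewrite lt_min r0.
rewrite lt_min => /andP[/hr h1 /hs h2].
rewrite [X in normc X <= _](_ : _ = (f (z + t%:C * v) - f z - t%:C * a)
  + (g (z + t%:C * v) - g z - t%:C * b)); last by ring.
by apply: le_trans (le_normcD _ _) _; lra.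
Qed.

Lemma ddir_near f g z v a (r : R) : normc v = 1 -> 0 < r ->
  (forall w, normc (w - z) < r -> f w = g w) -> ddir f z v a -> ddir g z v a.
Proof.
move=> v1 r0 fg fd e e0; have [s s0 hs] := fd _ e0.
exists (Num.min r s) => [|t]; first by rewrite lt_min r0.
rewrite lt_min => /andP[tr ts]; rewrite -!fg; first exact: hs.
  by rewrite subrr normc0.
by rewrite addrC addKr normcM v1 mulr1 normc_real.
Qed.

(** The boolean lets one argument serve both components of a complex weak derivative. *)
Definition ReIm (b : bool) (z : C) : R := if b then Re z else Im z.

Lemma ReImB b x y : ReIm b (x - y) = ReIm b x - ReIm b y.
Proof. by case: b x y => -[? ?] [? ?]. Qed.

Lemma ReIm_le b x : `|ReIm b x| <= normc x.
Proof. by case: b; [exact: normc_Re|exact: normc_Im]. Qed.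

Lemma ReImZ b (t : R) x : ReIm b (t%:C * x) = t * ReIm b x.
Proof. by case: b x => -[? ?]; rewrite /ReIm /=; ring. Qed.

Lemma ddir_is_derive (f : C -> C) (p v : plane) (a : C) (b : bool) :
  ddir f (p.1 +i* p.2) (v.1 +i* v.2) a ->
  is_derive p v (fun p : plane => ReIm b (f (p.1 +i* p.2))) (ReIm b a).
Proof.
move=> fd; apply: cder_is_derive => e e0; have [r r0 hr] := fd _ e0.
exists r => // t tr; apply: le_trans (hr t tr).
have -> : (t *: v + p).1 +i* (t *: v + p).2 = (p.1 +i* p.2) + t%:C * (v.1 +i* v.2).
  by apply/eqP; rewrite eq_complex /=; apply/andP; split; apply/eqP; rewrite /GRing.scale/=; ring.
by rewrite [ReIm b a * t]mulrC -ReImZ -!ReImB ReIm_le.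
Qed.

Lemma e1E : (@e1 R).1 +i* (@e1 R).2 = 1 :> C. Proof. by []. Qed.
Lemma e2E : (@e2 R).1 +i* (@e2 R).2 = 'i :> C. Proof. by []. Qed.

Lemma complex_weak_derivative (h : C -> C) (H : plane -> C) (L : R) (v : plane) :
  v = @e1 R \/ v = @e2 R -> 0 <= L ->
  (forall a b, normc (h a - h b) <= L * normc (a - b)) ->
  (forall p, circle p -> H p = 0) ->
  (forall p, ~ circle p -> ddir h (p.1 +i* p.2) (v.1 +i* v.2) (H p)) ->
  weak_derivativeC v (fun p => h (p.1 +i* p.2) : Cplane R) (H : plane -> Cplane R).
Proof.
move=> ve L0 hL H0 Hd.
have wd b : weak_derivative v (fun p : plane => ReIm b (h (p.1 +i* p.2))) (fun p => ReIm b (H p)).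
  (* The factor 2 passes from the modulus to the maximum norm of the plane. *)
  apply: (@lipschitz_weak_derivative R v _ _ (2 * L) (@circle R) ve).
  - move=> p p'; rewrite -ReImB; apply: le_trans (ReIm_le _ _) _.
    apply: le_trans (hL _ _) _; rewrite [2 * L]mulrC -mulrA ler_wpM2l//.
    apply: le_trans (normc_ReIm _) _ => /=.
    have := le_refl `|p - p'|; rewrite {2}prod_normE/= le_max ge_max => _.
    have h1 : `|p.1 - p'.1| <= `|p - p'| by rewrite prod_normE/= le_max lexx.
    have h2 : `|p.2 - p'.2| <= `|p - p'| by rewrite prod_normE/= le_max lexx orbT.
    by lra.
  - exact: measurable_circle.
  - exact: lebesgue2_circle.
  - by move=> p /H0 ->; case: b.
  - by move=> p /Hd hd; exact: ddir_is_derive.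
split; [exact: (wd true)|exact: (wd false)].
Qed.

Lemma circleP (p : plane) : circle p <-> normc (p.1 +i* p.2) = 1.
Proof.
split=> [h|h]; last first.
  by have := normc_sqr (p.1 +i* p.2); rewrite h expr1n => /esym.
have /eqP : normc (p.1 +i* p.2) ^+ 2 = 1 by rewrite normc_sqr; exact: h.
rewrite sqrf_eq1 => /orP[/eqP//|/eqP h1].
by have := normc_ge0 (p.1 +i* p.2); rewrite h1; lra.
Qed.

Lemma quasiconformal_extension (G : C -> C) (c : C) (k : R) : 0 <= k -> k < 1 -> c != 0 ->
  (forall w, normc w < 1 -> exists2 d, cder G w d & normc (d - c) <= k * normc c) ->
  exists h : C -> C, quasiconformal k (h : Cplane R -> Cplane R) /\
    forall z, normc z < 1 -> h z = G z.
Proof.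
move=> k0 k1 c0 Gd; have nc : 0 < normc c by rewrite normc_gt0.
pose g w := G w + - c * w; pose K := k * normc c.
have K0 : 0 <= K by rewrite mulr_ge0// ltW.
have Kc : K < normc c by rewrite /K gtr_pMl.
have gd w : normc w < 1 -> exists2 d, cder g w d & normc d <= K.
  move=> /Gd[d hd dK]; exists (d - c) => //.
  exact: (cderD hd (cder_scale (- c) w)).
have [phi [phiK phi_in phi_out]] := lipschitz_reflection K0 (lipschitz_disc gd).
pose h z := c * z + phi z.
have hG z : normc z < 1 -> h z = G z by move=> /phi_in; rewrite /h => ->; rewrite /g; ring.
have hL a b : normc (h a - h b) <= (normc c + K) * normc (a - b).
  rewrite (_ : h a - h b = c * (a - b) + (phi a - phi b)); last by rewrite /h; ring.
  apply: le_trans (le_normcD _ _) _; rewrite normcM mulrDl lerD2l; exact: phiK.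
have n1 : normc (1 : C) = 1 by exact: normc1.
have ni : normc ('i : C) = 1 by rewrite /= expr0n expr1n add0r sqrtr1.
(* With a = h_x and b = h_y, the sums a + ib and a - ib are 2 h_zbar and 2 h_z: inside the disc the
   first vanishes, outside they are 2D and 2c. *)
have dirs z : normc z != 1 -> exists a b, [/\ ddir h z 1 a, ddir h z 'i b &
    normc (a + 'i * b) <= k * normc (a - 'i * b)].
  move=> z1; have [zl|zg] := ltP (normc z) 1.
    have [d hd _] := Gd z zl; have r : 0 < 1 - normc z by lra.
    have near w : normc (w - z) < 1 - normc z -> G w = h w.
      by move=> hw; rewrite hG//; have := le_normcD (w - z) z; rewrite subrK; lra.
    exists (d * 1), (d * 'i); split.
    - exact: (ddir_near n1 r near (cder_ddir n1 hd)).
    - exact: (ddir_near ni r near (cder_ddir ni hd)).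
    - rewrite mulr1 mulrCA -expr2 sqr_i mulrN1 subrr normc0.
      by rewrite mulr_ge0// normc_ge0.
  have {}zg : 1 < normc z by rewrite lt_def z1.
  have z0 : conjc z != 0 by rewrite conjc_eq0 -normc_gt0; lra.
  have zi : normc (conjc z)^-1 < 1 by rewrite normcV normc_conj invf_lt1//; lra.
  have [d hd dK] := gd _ zi.
  have hd2 := cder_comp (cderV z0) hd.
  set D := d * _ in hd2.
  (* D is the derivative of v -> g(1/v) at v = conj(z); the factor 1/|z|^2 < 1 from the inversion
     only helps. *)
  have DK : normc D <= K.
    rewrite /D normcM normcN expr2 normcM; apply: le_trans dK.
    rewrite ler_piMr ?normc_ge0// mulr_ile1 ?normc_ge0//; exact: ltW.
  have r : 0 < normc z - 1 by lra.
  have near w : normc (w - z) < normc z - 1 -> c * w + g (conjc w)^-1 = h w.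
    move=> hw; rewrite /h phi_out//.
    by have := le_normcD (z - w) w; rewrite subrK normcB; lra.
  exists (c * 1 + D * conjc 1), (c * 'i + D * conjc 'i); split.
  - apply: (ddir_near n1 r near); apply: ddirD.
      exact: (cder_ddir n1 (cder_scale c z)).
    exact: (cder_conj_ddir n1 hd2).
  - apply: (ddir_near ni r near); apply: ddirD.
      exact: (cder_ddir ni (cder_scale c z)).
    exact: (cder_conj_ddir ni hd2).
  have i2 : 'i * 'i = -1 :> C by rewrite -expr2 sqr_i.
  have ci : conjc 'i = - 'i :> C by simpc.
  have -> : c * 1 + D * conjc 1 + 'i * (c * 'i + D * conjc 'i) = D *+ 2.
    rewrite conjc1 ci.
    have -> : c * 1 + D * 1 + 'i * (c * 'i + D * - 'i) = c + D + (c - D) * ('i * 'i) by ring.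
    by rewrite i2; ring.
  have -> : c * 1 + D * conjc 1 - 'i * (c * 'i + D * conjc 'i) = c *+ 2.
    rewrite conjc1 ci.
    have -> : c * 1 + D * 1 - 'i * (c * 'i + D * - 'i) = c + D - (c - D) * ('i * 'i) by ring.
    by rewrite i2; ring.
  by rewrite !normcMn mulrnAr ler_pMn2r.
(* On the circle both derivatives are set to 0, as [complex_weak_derivative] asks; the Beltrami
   inequality then holds at every point. *)
have /choice[ab Hab] : forall p : plane, exists ab : C * C,
    (circle p -> ab = (0, 0)) /\
    [/\ (~ circle p -> ddir h (p.1 +i* p.2) 1 ab.1),
       (~ circle p -> ddir h (p.1 +i* p.2) 'i ab.2) &
       normc (ab.1 + 'i * ab.2) <= k * normc (ab.1 - 'i * ab.2)].
  move=> p; have [cp|cp] := pselect (circle p).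
    have e0 : (0 : C) + 'i * 0 = 0 by rewrite mulr0 addr0.
    by exists (0, 0); split=> //; split=> //; rewrite [_ + _]e0 normc0 mulr_ge0// normc_ge0.
  have [|a [b [ha hb hk]]] := dirs (p.1 +i* p.2); first by apply/eqP => /circleP.
  by exists (a, b).
exists h; split; last exact: hG.
split; first exact: (perturbation_homeomorphism K0 Kc phiK).
have L0 : 0 <= normc c + K by rewrite addr_ge0// ltW.
exists (fun p => (ab p).1), (fun p => (ab p).2); split.
- apply: (complex_weak_derivative _ L0 hL); first by left.
    by move=> p /(proj1 (Hab p)) ->.
  by move=> p cp; have [_ [+ _ _]] := Hab p; rewrite e1E; apply.
- apply: (complex_weak_derivative _ L0 hL); first by right.
    by move=> p /(proj1 (Hab p)) ->.
  by move=> p cp; have [_ [_ + _]] := Hab p; rewrite e2E; apply.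
apply: aeW => p; have [_ [_ _ hk]] := Hab p.
rewrite !norm_normc -rmorphM lecR !normcM mulrA ler_wpM2r ?normc_ge0//.
Qed.

Lemma disc_normc (z : C) : (`|z| < 1) = (normc z < 1).
Proof. by rewrite norm_normc -ltcR. Qed.
End Directional.

Theorem corollary3p3 (R : realType) (q : Cplane R) (r : R)
  (hq : 0 < complex.Re q) (hr : 0 < r) (hrq : r0 R < r * complex.Re q)
  (G : Cplane R -> Cplane R) (hG : resolvents q r G) :
  exists h : Cplane R -> Cplane R,
    quasiconformal (A (r * complex.Re q)) h /\
    forall z : Cplane R, `|z| < 1 -> h z = G z.
Proof.
have [f [p [pd pre p0 fE]] [Gd G1 GE]] := hG.
have [k0 k1 _] := A_bounds hrq.
pose P (z : R[i]) : R[i] := r%:C * p z.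
have ReP z : complex.Re (P z) = r * complex.Re (p z).
  by rewrite /P; case: (p z) => a b; simpc.
have P0 : complex.Re (P 0) = r * complex.Re q by rewrite ReP p0.
have Pp : disc_pos P.
  split=> z z1; have z1' : `|z : Cplane R| < 1 by rewrite disc_normc.
    have [d hd] := derivable_cder (pd z z1').
    by exists (0 * p z + r%:C * d); exact: (cderM (cder_cst r%:C z) hd).
  by rewrite ReP mulr_ge0 ?(ltW hr)// pre.
have Gd' w : normc w < 1 -> exists d, cder G w d.
  by rewrite -disc_normc => /Gd /derivable_cder.
have G1' w : normc w < 1 -> normc (G w) < 1.
  by rewrite -disc_normc => /G1; rewrite disc_normc.
have GE' w : normc w < 1 -> G w * (1 + P (G w)) = w.
  rewrite -disc_normc => w1; rewrite -[RHS](GE w w1) fE ?G1//.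
  by rewrite /P mulrDr mulr1 mulrCA.
have xr : r0 R < complex.Re (P 0) by rewrite P0.
have kE : A (r * complex.Re q) = A (complex.Re (P 0)) by rewrite P0.
have [c c0 Gc] := resolvent_derivative Pp xr kE Gd' G1' GE'.
have [h [qh hE]] := quasiconformal_extension (ltW k0) k1 c0 Gc.
by exists h; split=> // z; rewrite disc_normc; exact: hE.
Qed.
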